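(* Let $\Omega$ be a compact Hausdorff space, let $E$ and $F$ be Banach spaces, and let $T: C(\Omega,E)\to F$ be a nuclear operator with representing measure $G$. Then: (i) for each Borel subset $B$ of $\Omega$, $G(B): E\to F$ is a nuclear operator; and (ii) the measure $G$ is countably additive and is of bounded variation as a vector measure taking its values in the space $\mathcal N(E,F)$ of nuclear operators from $E$ to $F$ under the nuclear norm.
   Context: Banach spaces are over $\mathbb R$ or $\mathbb C$. $C(\Omega,E)$ is the Banach space of continuous $E$-valued functions on $\Omega$ with the supremum norm. $\mathcal L(X,Y)$ is the space of bounded linear operators from $X$ to $Y$. Nuclear operators: $S\in\mathcal L(X,Y)$ is nuclear if there are sequences $(x_n^* )$ in $X^*$ and $(y_n)$ in $Y$ with $\sum_{n=1}^\infty \|x_n^*\|\,\|y_n\|<\infty$ and $S(x)=\sum_{n=1}^\infty x_n^*(x)y_n$ for all $x\in X$. The nuclear norm $\|S\|_{\mathrm{nuc}}$ is the infimum of $\sum_n\|x_n^*\|\,\|y_n\|$ over all such pairs of sequences representing $S$. $\mathcal N(X,Y)$ is the space of nuclear operators from $X$ to $Y$ with the nuclear norm. Representing measure: let $\Sigma$ be the Borel $\sigma$-field of $\Omega$. $M(\Omega,E^* )$ is the space of regular countably additive $E^*$-valued measures on $\Sigma$ of bounded variation, with the variation norm; it is identified isometrically with $C(\Omega,E)^*$ by integration. For $B\in\Sigma$ and $e\in E$ let $\phi_{B,e}\in M(\Omega,E^* )^*=C(\Omega,E)^{**}$ be given by $\phi_{B,e}(\lambda)=\lambda(B)(e)$.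 The representing measure of a bounded linear operator $T: C(\Omega,E)\to F$ is the finitely additive set function $G:\Sigma\to\mathcal L(E,F^{**})$ given by $G(B)e=T^{**}(\phi_{B,e})$. $F$ is regarded as a subspace of $F^{**}$ via the canonical embedding; (i) includes the assertion that $G(B)$ takes its values in $F$. Bounded variation in $\mathcal N(E,F)$ means $|G|_{\mathrm{nuc}}(\Omega)=\sup_\pi\sum_{B_i\in\pi}\|G(B_i)\|_{\mathrm{nuc}}<\infty$, the supremum being over all finite partitions $\pi$ of $\Omega$ into Borel sets. Countable additivity in (ii) is with respect to convergence in the nuclear norm. *)

(* Defs.v *)
(* MathComp / MathComp-Analysis *)
From HB Require Import structures.
From mathcomp Require Import all_boot all_order all_algebra.
From mathcomp Require Import all_classical all_reals all_analysis.
From mathcomp Require Import complex.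

Set Implicit Arguments.
Unset Strict Implicit.
Unset Printing Implicit Defensive.

Import Order.TTheory GRing.Theory Num.Theory.
Import numFieldNormedType.Exports.

Local Open Scope classical_set_scope.
Local Open Scope ring_scope.

Variant scalar_kind := RealScalars | ComplexScalars.

Definition scalar_field (R : realType) (k : scalar_kind) : numFieldType :=
  match k with RealScalars => R | ComplexScalars => R[i] end.

(* In a [normedModType (scalar_field R k)] the norm is valued in the scalar field;
   [scalar_re] reads it as a real number, and [scalar_of] is the inclusion
   of R in the scalar field. *)
Definition scalar_re (R : realType) (k : scalar_kind) : scalar_field R k -> R :=
  match k with RealScalars => id | ComplexScalars => @complex.Re R end.

Definition scalar_of (R : realType) (k : scalar_kind) : R -> scalar_field R k :=
  match k with RealScalars => id | ComplexScalars => fun r => Complex r 0 end.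

Arguments scalar_of {R} k.

Section scalar_theory.
Context {R : realType} {k : scalar_kind}.
Implicit Types (x y : scalar_field R k) (r s : R).

Lemma scalar_ofK : cancel (@scalar_of R k) (@scalar_re R k).
Proof. by case: k. Qed.

Lemma scalar_reK x : 0 <= x -> scalar_of k (scalar_re x) = x.
Proof.
case: k x => //= -[a b].
by rewrite lecE /= => /andP[/eqP -> _].
Qed.

Lemma scalar_re_le x y : x <= y -> scalar_re x <= scalar_re y.
Proof.
case: k x y => //= -[a b] [c d].
by rewrite lecE /= => /andP[_].
Qed.

Lemma scalar_re0 : scalar_re (0 : scalar_field R k) = 0.
Proof. by case: k. Qed.

Lemma scalar_reD x y : scalar_re (x + y) = scalar_re x + scalar_re y.
Proof. by case: k x y => //= -[a b] [c d]. Qed.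

Lemma scalar_ofD r s : scalar_of k (r + s) = scalar_of k r + scalar_of k s.
Proof. by case: k => //=; apply/eqP; rewrite eq_complex /= addr0 !eqxx. Qed.

Lemma scalar_ofM r s : scalar_of k (r * s) = scalar_of k r * scalar_of k s.
Proof.
by case: k => //=; apply/eqP; rewrite eq_complex /= !(mulr0, mul0r, subr0, addr0) !eqxx.
Qed.

Lemma scalar_of_le r s : r <= s -> scalar_of k r <= scalar_of k s.
Proof. by case: k => //= rs; rewrite lecE /= eqxx. Qed.

Lemma scalar_re_lt x y : x < y -> scalar_re x < scalar_re y.
Proof.
case: k x y => //= -[a b] [c d].
by rewrite ltcE /= => /andP[_].
Qed.

Lemma scalar_of_gt0 r : 0 < r -> 0 < scalar_of k r.
Proof. by case: k => //= r0; rewrite ltcE /= eqxx. Qed.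

Lemma scalar_reM_ge0 x y : 0 <= x -> 0 <= y ->
  scalar_re (x * y) = scalar_re x * scalar_re y.
Proof.
move=> x0 y0; rewrite -{1}(scalar_reK x0) -{1}(scalar_reK y0).
by rewrite -scalar_ofM scalar_ofK.
Qed.

End scalar_theory.

Definition rnorm (R : realType) (k : scalar_kind)
  (V : normedModType (scalar_field R k)) (v : V) : R := scalar_re `|v|.

Section rnorm_theory.
Context {R : realType} {k : scalar_kind} {V : normedModType (scalar_field R k)}.
Implicit Types v w : V.

Lemma rnorm_ge0 v : 0 <= rnorm v.
Proof. by rewrite /rnorm -(@scalar_re0 R k) scalar_re_le. Qed.

Lemma rnormD v w : rnorm (v + w) <= rnorm v + rnorm w.
Proof. by rewrite /rnorm -scalar_reD scalar_re_le// ler_normD. Qed.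

Lemma rnormZ (a : scalar_field R k) v : rnorm (a *: v) = scalar_re `|a| * rnorm v.
Proof. by rewrite /rnorm normrZ scalar_reM_ge0. Qed.

Lemma rnorm0 : rnorm (0 : V) = 0.
Proof. by rewrite /rnorm normr0 scalar_re0. Qed.

Lemma rnorm_eq0 v : rnorm v = 0 -> v = 0.
Proof.
move=> v0; apply/eqP; rewrite -normr_eq0 -(@scalar_reK R k `|v|)//.
by rewrite -[scalar_re _]/(rnorm v) v0 -(@scalar_re0 R k) scalar_reK.
Qed.

Lemma rnormN v : rnorm (- v) = rnorm v.
Proof. by rewrite /rnorm normrN. Qed.

Lemma ler_dist_rnorm v w : `|rnorm v - rnorm w| <= rnorm (v - w).
Proof.
rewrite ler_norml lerBlDr -{3}(subrK w v) rnormD andbT lerNl opprB lerBlDr.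
by rewrite -{1}(subrK v w) -(rnormN (v - w)) opprB rnormD.
Qed.

Lemma rnorm_continuous : continuous (@rnorm R k V).
Proof.
move=> v; apply/cvgrPdist_lt => e e0.
have : \forall w \near nbhs v, `|v - w| < scalar_of k e.
  by apply: cvgr_dist_lt => //; exact: scalar_of_gt0.
apply: filterS => w /scalar_re_lt; rewrite scalar_ofK.
exact: le_lt_trans (ler_dist_rnorm _ _).
Qed.

End rnorm_theory.

(* C(Omega, E); compactness of Omega, which makes the supremum norm finite, is a
   parameter of the type. *)
Definition cfun (Omega : topologicalType) (cO : compact [set: Omega])
  (E : topologicalType) := continuousType Omega E.

Section cfun_normedMod.
Context {R : realType} {k : scalar_kind} {Omega : topologicalType}.
Context {cO : compact [set: Omega]} {E : normedModType (scalar_field R k)}.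
Local Notation C := (cfun cO E).
Implicit Types f g h : C.

HB.instance Definition _ := Choice.on C.

Lemma cfunP f g : (forall t, f t = g t) -> f = g.
Proof. by move=> fg; apply/continuousEP. Qed.

Let cadd_cts f g : continuous (fun t => f t + g t).
Proof. by move=> t; exact: (cvgD (@cts_fun _ _ f t) (@cts_fun _ _ g t)). Qed.
Let copp_cts f : continuous (fun t => - f t).
Proof. by move=> t; exact: (cvgN (@cts_fun _ _ f t)). Qed.
Let cscale_cts (a : scalar_field R k) f : continuous (fun t => a *: f t).
Proof. by move=> t; exact: (cvgZl_tmp (@cts_fun _ _ f t)). Qed.

Definition cfun0 : C := @cst Omega E 0.
Definition cfun_add f g : C := mkcts (@cadd_cts f g).
Definition cfun_opp f : C := mkcts (@copp_cts f).
Definition cfun_scale (a : scalar_field R k) f : C := mkcts (@cscale_cts a f).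

Let cfun_addA : associative cfun_add.
Proof. by move=> f g h; apply: cfunP => t /=; rewrite /mkcts addrA. Qed.
Let cfun_addC : commutative cfun_add.
Proof. by move=> f g; apply: cfunP => t /=; rewrite /mkcts addrC. Qed.
Let cfun_add0 : left_id cfun0 cfun_add.
Proof. by move=> f; apply: cfunP => t /=; rewrite /mkcts add0r. Qed.
Let cfun_addN : left_inverse cfun0 cfun_opp cfun_add.
Proof. by move=> f; apply: cfunP => t /=; rewrite /mkcts addNr. Qed.

HB.instance Definition _ :=
  GRing.isZmodule.Build C cfun_addA cfun_addC cfun_add0 cfun_addN.

Let cfun_scaleA a b f : cfun_scale a (cfun_scale b f) = cfun_scale (a * b) f.
Proof. by apply: cfunP => t /=; rewrite /mkcts scalerA. Qed.
Let cfun_scale1 : left_id 1 cfun_scale.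
Proof. by move=> f; apply: cfunP => t /=; rewrite /mkcts scale1r. Qed.
Let cfun_scaleDr : right_distributive cfun_scale +%R.
Proof. by move=> a f g; apply: cfunP => t /=; rewrite /mkcts scalerDr. Qed.
Let cfun_scaleDl f a b :
  cfun_scale (a + b) f = cfun_scale a f + cfun_scale b f.
Proof. by apply: cfunP => t /=; rewrite /mkcts scalerDl. Qed.

HB.instance Definition _ := GRing.Zmodule_isLmodule.Build (scalar_field R k) C
  cfun_scaleA cfun_scale1 cfun_scaleDr cfun_scaleDl.

Lemma cfunDE f g t : (f + g) t = f t + g t. Proof. by []. Qed.
Lemma cfunNE f t : (- f) t = - f t. Proof. by []. Qed.
Lemma cfunZE (a : scalar_field R k) f t : (a *: f) t = a *: f t. Proof. by []. Qed.
Lemma cfun0E t : (0 : C) t = 0. Proof. by []. Qed.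

Definition cfun_supnorm f : R := sup [set rnorm (f t) | t in [set: Omega]].

Lemma cfun_has_ubound f : has_ubound [set rnorm (f t) | t in [set: Omega]].
Proof.
have : compact ((fun t => rnorm (f t)) @` [set: Omega]).
  apply: continuous_compact => //; apply: continuous_subspaceT => t.
  exact: (continuous_comp (@cts_fun _ _ f t) (@rnorm_continuous R k E (f t))).
move=> /(@compact_bounded R R^o) /pinfty_ex_gt0[M M0 fM]; exists M => _ [t _ <-].
by rewrite (le_trans (ler_norm _))//; apply: fM; exists t.
Qed.

Lemma cfun_supnorm_ge f t : rnorm (f t) <= cfun_supnorm f.
Proof. by apply: ub_le_sup; [exact: cfun_has_ubound | exists t]. Qed.

Lemma cfun_supnorm_le f r : 0 <= r -> (forall t, rnorm (f t) <= r) ->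
  cfun_supnorm f <= r.
Proof.
move=> r0 fr; rewrite /cfun_supnorm.
have [->|/set0P A0] := eqVneq [set rnorm (f t) | t in [set: Omega]] set0.
  by rewrite sup0.
by apply: ge_sup => // _ [t _ <-].
Qed.

Lemma cfun_supnorm_ge0 f : 0 <= cfun_supnorm f.
Proof.
rewrite /cfun_supnorm.
have [->|/set0P[_ [t _ _]]] := eqVneq [set rnorm (f t) | t in [set: Omega]] set0.
  by rewrite sup0.
by rewrite (le_trans (rnorm_ge0 (f t)))// (cfun_supnorm_ge f t).
Qed.

Definition cfun_norm f : scalar_field R k := scalar_of k (cfun_supnorm f).

Let cfun_normD f g : cfun_norm (f + g) <= cfun_norm f + cfun_norm g.
Proof.
rewrite /cfun_norm -scalar_ofD scalar_of_le// cfun_supnorm_le//.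
  by rewrite addr_ge0 ?cfun_supnorm_ge0.
by move=> t; rewrite (le_trans (rnormD _ _))// lerD ?cfun_supnorm_ge.
Qed.

Let cfun_supnormZ_le (a : scalar_field R k) f :
  cfun_supnorm (a *: f) <= scalar_re `|a| * cfun_supnorm f.
Proof.
have a0 : 0 <= scalar_re `|a| by rewrite -(@scalar_re0 R k) scalar_re_le.
apply: cfun_supnorm_le; first by rewrite mulr_ge0 ?cfun_supnorm_ge0.
by move=> t; rewrite cfunZE rnormZ ler_wpM2l ?cfun_supnorm_ge.
Qed.

Let cfun_normZ (a : scalar_field R k) f : cfun_norm (a *: f) = `|a| * cfun_norm f.
Proof.
rewrite /cfun_norm -[in RHS](@scalar_reK R k `|a|)// -scalar_ofM.
congr (scalar_of k _); apply/eqP; rewrite eq_le cfun_supnormZ_le/=.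
have [->|a0] := eqVneq a 0.
  by rewrite normr0 scalar_re0 mul0r cfun_supnorm_ge0.
have na0 : 0 < scalar_re `|a|.
  rewrite lt0r -{2}(@scalar_re0 R k) scalar_re_le// andbT.
  apply: contra a0 => /eqP a0; rewrite -normr_eq0 -(@scalar_reK R k `|a|)// a0.
  by rewrite -(@scalar_re0 R k) scalar_reK.
rewrite -ler_pdivlMl// -{1}[f](scalerK a0) (le_trans (cfun_supnormZ_le _ _))//.
rewrite ler_wpM2r ?cfun_supnorm_ge0// -[leRHS]mul1r ler_pdivlMr//.
rewrite -scalar_reM_ge0// -normrM mulVf// normr1.
by case: (k).
Qed.

Let cfun_norm0_eq0 f : cfun_norm f = 0 -> f = 0.
Proof.
move=> f0; apply: cfunP => t; rewrite cfun0E; apply: rnorm_eq0.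
apply/eqP; rewrite eq_le rnorm_ge0 andbT (le_trans (cfun_supnorm_ge f t))//.
by rewrite -(@scalar_ofK R k (cfun_supnorm f)) -/(cfun_norm f) f0 scalar_re0.
Qed.

HB.instance Definition _ := Lmodule_isNormed.Build (scalar_field R k) C
  cfun_normD cfun_normZ cfun_norm0_eq0.

End cfun_normedMod.

Section operators.
Context {R : realType} {k : scalar_kind}.

Definition bounded_operators (X Y : normedModType (scalar_field R k)) : {pred X -> Y} :=
  mem [set S : X -> Y | linear S /\ continuous S].

Arguments bounded_operators X Y : clear implicits.

Record operator (X Y : normedModType (scalar_field R k)) := Operator {
  operator_fun :> X -> Y ;
  operatorP : operator_fun \in bounded_operators X Y }.

Section operator_lmod.
Context {X Y : normedModType (scalar_field R k)}.

HB.instance Definition _ := [isSub for @operator_fun X Y].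
HB.instance Definition _ := [Choice of operator X Y by <:].

Let bounded_operators_submod : submod_closed (bounded_operators X Y).
Proof.
split.
  rewrite inE; split=> [a u v|]; first by rewrite /= scaler0 addr0.
  by move=> x; exact: cvg_cst.
move=> a S U; rewrite !inE => -[lS cS] [lU cU]; split=> [b u v|x].
  rewrite /= !fctE lS lU !scalerDr !scalerA mulrC.
  by rewrite addrACA.
by apply: cvgD; [apply: cvgZl_tmp; exact: cS | exact: cU].
Qed.

HB.instance Definition _ := GRing.isSubmodClosed.Build (scalar_field R k) (X -> Y)
  (bounded_operators X Y) bounded_operators_submod.
HB.instance Definition _ :=
  [SubChoice_isSubLmodule of operator X Y by <:].

End operator_lmod.

Lemma operator_linear (X Y : normedModType (scalar_field R k)) (S : operator X Y) :
  linear S.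
Proof. by case: S => S /=; rewrite inE => -[]. Qed.

Lemma operator_continuous (X Y : normedModType (scalar_field R k)) (S : operator X Y) :
  continuous S.
Proof. by case: S => S /=; rewrite inE => -[]. Qed.

HB.instance Definition _ (X Y : normedModType (scalar_field R k)) (S : operator X Y) :=
  GRing.isLinear.Build (scalar_field R k) X Y *:%R S (operator_linear S).

Lemma operator_comp_subproof (X Y Z : normedModType (scalar_field R k))
    (U : operator Y Z) (S : operator X Y) :
  (fun x => U (S x)) \in bounded_operators X Z.
Proof.
rewrite inE; split=> [a u v|x]; first by rewrite !linearP.
apply: continuous_comp; exact: operator_continuous.
Qed.

Definition operator_comp (X Y Z : normedModType (scalar_field R k))
    (U : operator Y Z) (S : operator X Y) : operator X Z :=
  Operator (operator_comp_subproof U S).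

Definition dual_space (X : normedModType (scalar_field R k)) :=
  operator X ((scalar_field R k)^o : normedModType (scalar_field R k)).

Definition canonical_embedding (X : normedModType (scalar_field R k)) (x : X) :
    dual_space X -> scalar_field R k :=
  fun l => l x.

(* The second adjoint S^**, applied to a functional phi on X^*: the value at
   y^* in Y^* is phi (S^* y^* ), where S^* y^* = y^* o S. *)
Definition second_adjoint (X Y : normedModType (scalar_field R k)) (S : operator X Y)
    (phi : dual_space X -> scalar_field R k) : dual_space Y -> scalar_field R k :=
  fun l => phi (operator_comp l S).

Definition opnorm (X Y : normedModType (scalar_field R k)) (S : operator X Y) : \bar R :=
  ereal_sup [set (rnorm (S x))%:E | x in [set x : X | rnorm x <= 1]].

Definition nuclear_representation (X Y : normedModType (scalar_field R k))
    (S : operator X Y) (l : nat -> dual_space X) (y : nat -> Y) :=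
  forall x, series (fun n => l n x *: y n) @ \oo --> S x.

Definition nuclear_sum (X Y : normedModType (scalar_field R k))
    (l : nat -> dual_space X) (y : nat -> Y) : \bar R :=
  (\sum_(0 <= n <oo) opnorm (l n) * (rnorm (y n))%:E)%E.

Definition nuclear (X Y : normedModType (scalar_field R k)) (S : operator X Y) :=
  exists l y, nuclear_representation S l y /\ (nuclear_sum l y < +oo)%E.

(* Equal to +oo exactly when S is not nuclear. *)
Definition nuclear_norm (X Y : normedModType (scalar_field R k)) (S : operator X Y)
    : \bar R :=
  ereal_inf [set s | exists l y,
    nuclear_representation S l y /\ s = nuclear_sum l y].

End operators.

Arguments opnorm {R k X Y} S.
Arguments nuclear_norm {R k X Y} S.

Section vector_measures.
Context {Omega : topologicalType}.

Definition borel : set (set Omega) := <<s @open Omega >>.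

Definition borel_partition (n : nat) (P : 'I_n -> set Omega) :=
  [/\ forall i, borel (P i), trivIset [set: 'I_n] P
    & \bigcup_i P i = [set: Omega]].

Context {R : realType} {V : zmodType}.
(* N is a norm on V, or on a subspace of V and then +oo outside of it; set
   functions are total, but only their values on Borel sets matter. *)
Implicit Types (N : V -> \bar R) (m : set Omega -> V).

Definition setfun_countably_additive N m := forall B : nat -> set Omega,
  (forall n, borel (B n)) -> trivIset [set: nat] B ->
  N (m (\bigcup_i B i) - \sum_(i < n) m (B i)) @[n --> \oo] --> 0%E.

Definition setfun_variation N m : \bar R :=
  ereal_sup [set s | exists n (P : 'I_n -> set Omega),
    borel_partition P /\ s = (\sum_(i < n) N (m (P i)))%E].

Definition setfun_bounded_variation N m := (setfun_variation N m < +oo)%E.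

Definition setfun_regular N m := forall B, borel B -> forall e : R, 0 < e ->
  exists C U, [/\ compact C, open U, C `<=` B, B `<=` U
    & forall A, borel A -> A `<=` U `\` C -> (N (m A) < e%:E)%E].

End vector_measures.

Section representing_measure.
Context {R : realType} {k : scalar_kind} {Omega : topologicalType}.
Context {cO : compact [set: Omega]} {E : normedModType (scalar_field R k)}.
Local Notation K := (scalar_field R k).
Implicit Types (lambda : set Omega -> dual_space E) (l : dual_space (cfun cO E)).

(* M(Omega, E^* ) *)
Definition regular_measures : set (set Omega -> dual_space E) :=
  [set lambda | [/\ setfun_countably_additive opnorm lambda,
    setfun_regular opnorm lambda
    & setfun_bounded_variation opnorm lambda]].

Definition simple_function (s : Omega -> E) :=
  finite_set (range s) /\ forall e, borel (s @^-1` [set e]).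

Definition simple_integral lambda (s : Omega -> E) : K :=
  \sum_(e \in range s) lambda (s @^-1` [set e]) e.

(* v is the integral of f with respect to lambda: the limit of the integrals of
   simple functions converging uniformly to f. *)
Definition is_integral lambda (f : Omega -> E) (v : K) :=
  exists s : nat -> Omega -> E, [/\ forall n, simple_function (s n),
    {uniform, s @ \oo --> f}
    & simple_integral lambda (s n) @[n --> \oo] --> (v : K^o)].

Definition represents lambda l := forall f : cfun cO E, is_integral lambda f (l f).

(* The identification of C(Omega, E)^* with M(Omega, E^* ): the measure
   representing l, which for Omega compact Hausdorff exists and is unique on Borel
   sets by Singer's theorem. *)
Definition measure_of l : set Omega -> dual_space E :=
  xget (fun=> 0) [set lambda | regular_measures lambda /\ represents lambda l].

(* phi_{B,e} : lambda |-> lambda(B)(e), as a functional on C(Omega, E)^* *)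
Definition evaluation (B : set Omega) (e : E) : dual_space (cfun cO E) -> K :=
  fun l => measure_of l B e.

Definition representing_measure (F : normedModType K)
    (T : operator (cfun cO E) F) (B : set Omega) (e : E) : dual_space F -> K :=
  second_adjoint T (evaluation B e).

End representing_measure.

(* Main.v *)
Require Import Defs.
From mathcomp Require Import all_boot all_order all_algebra.
From mathcomp Require Import all_classical all_reals all_analysis.
From mathcomp Require Import complex ring lra.
Import Order.TTheory GRing.Theory Num.Theory.
Import numFieldNormedType.Exports.
Local Open Scope classical_set_scope.
Local Open Scope ring_scope.
Set Implicit Arguments.
Unset Strict Implicit.
Unset Printing Implicit Defensive.

(** Write T f as the sum of the l_n(f) y_n, where the norms of l_n times those of
    y_n are summable. If lambda_n is the measure representing l_n, then
    G(B) e is the sum of the lambda_n(B)(e) y_n. As the norm of lambda_n(B) is at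
    most that of l_n, this series defines a nuclear operator with values in F.
    The variation of G in the nuclear norm is at most the sum of the variations of
    lambda_n times the norms of y_n, and countable additivity holds because the
    nuclear norm of G(D) is small when D lies in a small open set.

    The substance is therefore the representation of functionals on C(Omega, E)
    by regular measures (Singer's theorem) and the fact that the representing
    measure depends on the functional in a way compatible with infinite sums.
    Existence is obtained without scalar measure theory. The content of a
    functional l on an open set U is the supremum of |l f| over the f in the unit
    ball that vanish off U. It is monotone, subadditive and tight
    ([content_of_tight]), and for any tight content the Borel sets can be squeezed
    between a closed and an open set of nearly equal content
    ([borel_approximable]). By Urysohn's lemma the function with value e on a Borel
    set B and 0 elsewhere then agrees, off open sets of small content, with bounded
    continuous functions f, and the values l f converge. The limit, the Lusin
    integral, is lambda(B)(e). It satisfies a bound ([lusin_bound]) from which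
    regularity, countable additivity, bounded variation and the representation of
    l all follow.

    Uniqueness ([represents_uniq]) compares a regular measure lambda with l on a
    Urysohn function phi for a closed subset and an open superset of B: a
    staircase close to phi has as integral an average of values of lambda on sets
    lying between the two ([staircase_average]).

    For the nuclear operator itself, the sum v of the contents of the l_n weighted
    by the norms of the y_n is again a tight content. With respect to v the vector
    G(B) e is the limit of T f over the same functions f as above, so for every
    functional y' on F the measure with values y' o G(B) consists of Lusin integrals
    for y' o T, hence represents y' o T ([nuclear_measure_representing]). Finally
    the nuclear norm of G(D) is at most v(O) whenever D is contained in the open
    set O ([nuclear_measure_small]), which gives countable additivity
    ([content_countably_additive]). *)

(** * Estimates in the real numbers *)

Lemma ler_addeps (R : realType) (x a c : R) :
  (forall e, 0 < e -> x <= a + c * e) -> x <= a.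
Proof.
move=> h; apply/ler_addgt0Pr => e e0.
have c0 : 0 < `|c| + 1 by rewrite ltr_wpDl.
have /h/le_trans : 0 < e / (`|c| + 1) by rewrite divr_gt0.
apply; rewrite lerD2l mulrCA ger_pMr// ler_pdivrMr// mul1r.
by rewrite (le_trans (ler_norm _))// lerDl.
Qed.

Lemma geo_half_le (R : realType) (e : R) n : 0 < e -> \sum_(i < n) e / (2 ^ i.+1)%:R <= e.
Proof.
move=> e0; suff -> : \sum_(i < n) e / (2 ^ i.+1)%:R = e - e / (2 ^ n)%:R.
  by rewrite gerBl divr_ge0// ltW.
elim: n => [|n IH]; first by rewrite big_ord0 expn0 divr1 subrr.
rewrite big_ord_recr /= IH expnS natrM.
have : (2 ^ n)%:R != 0 :> R by rewrite pnatr_eq0 expn_eq0.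
by move=> ?; field.
Qed.

Lemma invSn_small (R : realType) (e : R) : 0 < e ->
  \forall n \near \oo, n.+1%:R^-1 < e.
Proof.
move=> e0; exists (Num.truncn e^-1) => //= n Nn.
rewrite invf_plt ?posrE//; apply: lt_le_trans (truncnS_gt _) _.
by rewrite ler_nat ltnS.
Qed.

(** * Real and complex scalars, bounded operators *)

Section scalars.
Context {R : realType} {k : scalar_kind}.
Local Notation K := (scalar_field R k).
Local Notation Kn := (K^o : normedModType K).

Lemma scalar_of0 : scalar_of k 0 = 0 :> K. Proof. by case: (k). Qed.

Lemma scalar_of1 : scalar_of k 1 = 1 :> K. Proof. by case: (k). Qed.

Lemma scalar_ofN (r : R) : scalar_of k (- r) = - scalar_of k r :> K.
Proof. by case: (k) => //=; apply/eqP; rewrite eq_complex /= oppr0 !eqxx. Qed.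

Lemma scalar_ofB (r s : R) :
  scalar_of k (r - s) = scalar_of k r - scalar_of k s :> K.
Proof. by rewrite scalar_ofD scalar_ofN. Qed.

Lemma ger0_norm_scalar_of r : 0 <= r -> `|scalar_of k r : K| = scalar_of k r.
Proof.
by move=> r0; apply: ger0_norm; rewrite -scalar_of0 scalar_of_le.
Qed.

Lemma rnorm_scalar_of (r : R) : rnorm (scalar_of k r : Kn) = `|r|.
Proof.
rewrite /rnorm /=; wlog r0 : r / 0 <= r => [hw|].
  have [/hw//|/ltW r0] := leP 0 r.
  by rewrite -normrN -scalar_ofN -(normrN r) hw // oppr_ge0.
rewrite (ger0_norm r0); have /= -> := ger0_norm_scalar_of r0.
exact: scalar_ofK.
Qed.

Lemma rnormZr (V : normedModType K) (r : R) (v : V) :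
  rnorm (scalar_of k r *: v) = `|r| * rnorm v.
Proof. by rewrite rnormZ; congr (_ * _); exact: rnorm_scalar_of. Qed.

Lemma rnormZ1 (V : normedModType K) (a : K) (v : V) :
  `|a| = 1 -> rnorm (a *: v) = rnorm v.
Proof.
by move=> a1; rewrite rnormZ a1 -scalar_of1 scalar_ofK mul1r.
Qed.

Lemma scalar_ofMn (n : nat) (r : R) :
  scalar_of k (n%:R * r) = scalar_of k r *+ n :> K.
Proof.
elim: n => [|n IH]; first by rewrite mul0r mulr0n scalar_of0.
by rewrite -natr1 mulrDl mul1r scalar_ofD IH mulrSr.
Qed.

Lemma rnorm_lt (V : normedModType K) (v : V) (e : R) :
  (rnorm v < e) = (`|v| < scalar_of k e).
Proof.
apply/idP/idP => [ve|/scalar_re_lt]; last by rewrite scalar_ofK.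
rewrite -(@scalar_reK R k `|v|)// lt_neqAle scalar_of_le ?(ltW ve)// andbT.
apply/eqP => /(congr1 (@scalar_re R k)); rewrite !scalar_ofK => h.
by move: ve; rewrite /rnorm h ltxx.
Qed.

Lemma gt0_scalar_of (e : K) : 0 < e -> exists2 r : R, 0 < r & scalar_of k r = e.
Proof.
move=> e0; exists (scalar_re e); last by rewrite scalar_reK ?ltW.
by rewrite -(@scalar_re0 R k) scalar_re_lt.
Qed.

Lemma cvg_rnormP (V : normedModType K) (T : Type) (F : set_system T) {FF : Filter F}
    (f : T -> V) (z : V) :
  f @ F --> z <-> forall e : R, 0 < e -> \forall t \near F, rnorm (z - f t) < e.
Proof.
split => [/cvgrPdist_lt h e e0|h].
  have /h : 0 < scalar_of k e by exact: scalar_of_gt0.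
  by apply: filterS => t; rewrite rnorm_lt.
apply/cvgrPdist_lt => e /gt0_scalar_of[r r0 <-].
by apply: filterS (h r r0) => t; rewrite rnorm_lt.
Qed.

Lemma continuous_scale (T : topologicalType) (V : normedModType K)
    (phi : T -> R) (f : T -> V) : continuous phi -> continuous f ->
  continuous (fun t => scalar_of k (phi t) *: f t).
Proof.
move=> cphi cf t; apply: cvgZ; last exact: cf.
apply/(@cvg_rnormP Kn) => e e0.
have /cvgrPdist_lt/(_ e e0) := cphi t.
by apply: filterS => u; rewrite -scalar_ofB rnorm_scalar_of.
Qed.

Lemma operator_bounded (X Y : normedModType K) (S : operator X Y) :
  exists2 c : R, 0 <= c & forall x, rnorm (S x) <= c * rnorm x.
Proof.
have /linear_boundedP : bounded_near S (nbhs (0 : X)).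
  apply/continuous_linear_bounded; exact: operator_continuous.
move=> /pinfty_ex_gt0[_ /gt0_scalar_of[r r0 <-] h].
exists r; first exact: ltW.
move=> x; have /scalar_re_le := h x.
by rewrite scalar_reM_ge0 ?scalar_ofK// ltW// scalar_of_gt0.
Qed.

Lemma bounded_operator (X Y : normedModType K) (S : X -> Y) (c : R) :
  linear S -> (forall x, rnorm (S x) <= c * rnorm x) ->
  S \in @bounded_operators R k X Y.
Proof.
move=> lS Sc; rewrite inE; split => // x.
apply/cvg_rnormP => e e0.
have /cvg_rnormP : (fun y : X => y) @ nbhs x --> x by exact: cvg_id.
have c0 : 0 < `|c| + 1 by rewrite ltr_wpDl.
move=> /(_ (e / (`|c| + 1))); rewrite divr_gt0// => /(_ isT).
apply: filterS => y; rewrite ltr_pdivlMr// => h.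
have -> : S x - S y = S (x - y).
  by rewrite [x - y]addrC -[- y]scaleN1r lS scaleN1r addrC.
apply: le_lt_trans (Sc _) _; apply: le_lt_trans h.
rewrite mulrC ler_wpM2l ?rnorm_ge0//.
by rewrite (le_trans (ler_norm _))// lerDl.
Qed.

Lemma cauchy_rnorm_cvg (V : completeNormedModType K) (u : nat -> V) :
  (forall e : R, 0 < e -> exists N, forall m n, (N <= m)%N -> (N <= n)%N ->
     rnorm (u m - u n) < e) ->
  exists z : V, u @ \oo --> z.
Proof.
move=> h; suff /cauchy_cvg : cauchy (u @ \oo) by exists (lim (u @ \oo)).
apply: cauchy_exP => _ /gt0_scalar_of[e e0 <-].
have [N hN] := h e e0; exists (u N); exists N => // n /= Nn.
by rewrite -ball_normE /ball_ /= -rnorm_lt hN.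
Qed.

(** Multiplication by such a scalar makes the value of a functional a nonnegative
    real, so that a sum of moduli becomes the modulus of a single value. *)
Lemma rotation (x : K) :
  exists2 u : K, `|u| = 1 & u * x = scalar_of k (rnorm (x : Kn)).
Proof.
have [->|x0] := eqVneq x 0.
  by exists 1; rewrite ?normr1// mulr0 rnorm0 scalar_of0.
exists (`|x| / x).
  by rewrite normrM normfV normr_id divff// normr_eq0.
by rewrite divfK// /rnorm /= scalar_reK.
Qed.


End scalars.

(** Over the complex numbers, the real and imaginary parts are Cauchy sequences. *)
Lemma scalar_complete (R : realType) (k : scalar_kind)
    (u : nat -> scalar_field R k) :
  (forall e : R, 0 < e -> exists N, forall m n, (N <= m)%N -> (N <= n)%N ->
     scalar_re `|u m - u n| < e) ->
  exists z, forall e : R, 0 < e -> \forall n \near \oo, scalar_re `|z - u n| < e.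
Proof.
case: k u => /= u h.
  have [|z uz] := @cauchy_rnorm_cvg R RealScalars R u; first exact: h.
  exists z; exact: (iffLR (@cvg_rnormP R RealScalars R _ _ _ u z)).
have ReE : forall x : R[i], `|complex.Re x| <= complex.Re `|x|.
  case=> a b; rewrite normc_def /=.
  by rewrite -sqrtr_sqr ler_wsqrtr// lerDl sqr_ge0.
have ImE : forall x : R[i], `|complex.Im x| <= complex.Re `|x|.
  case=> a b; rewrite normc_def /=.
  by rewrite -sqrtr_sqr ler_wsqrtr// lerDr sqr_ge0.
have part (p : R[i] -> R) : (forall x y, p (x - y) = p x - p y) ->
    (forall x : R[i], `|p x| <= complex.Re `|x|) ->
    exists z : R, p \o u @ \oo --> z.
  move=> pB pE; have [e e0|z uz] := @cauchy_rnorm_cvg R RealScalars R (p \o u); last first.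
    by exists z; exact: uz.
  have [N hN] := h e e0; exists N => m n Nm Nn.
  by rewrite /rnorm /= -pB (le_lt_trans (pE _))// hN.
have [|a ua] := part _ _ ReE; first by case=> ? ? [].
have [|b ub] := part _ _ ImE; first by case=> ? ? [].
exists (Complex a b) => e e0.
have e2 : 0 < e / 2 by rewrite divr_gt0.
have /cvgrPdist_lt/(_ _ e2) na := ua.
have /cvgrPdist_lt/(_ _ e2) nb := ub.
near=> n.
have ha : `|a - complex.Re (u n)| < e / 2 by near: n.
have hb : `|b - complex.Im (u n)| < e / 2 by near: n.
case: (u n) ha hb => c d /= ha hb.
rewrite -(sqrtr_sqr (a - c)) in ha; rewrite -(sqrtr_sqr (b - d)) in hb.
apply: (@le_lt_trans _ _ (Num.sqrt ((a - c) ^+ 2) + Num.sqrt ((b - d) ^+ 2))).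
  rewrite -[leRHS]ger0_norm ?addr_ge0 ?sqrtr_ge0//.
  rewrite -[X in _ <= X]sqrtr_sqr ler_wsqrtr//.
  rewrite [leRHS]sqrrD !sqr_sqrtr ?sqr_ge0// addrAC lerDl.
  by rewrite mulrn_wge0// mulr_ge0 ?sqrtr_ge0.
by rewrite (splitr e) ltrD.
Unshelve. all: by end_near. Qed.

Section operator_norm.
Context {R : realType} {k : scalar_kind}.
Local Notation K := (scalar_field R k).
Context {X Y : normedModType K}.
Implicit Types S : operator X Y.

Lemma opnorm_ge0 S : (0 <= opnorm S)%E.
Proof.
apply: ereal_sup_ubound; exists 0; rewrite /= ?linear0 ?rnorm0//.
Qed.

Lemma opnorm_le S (c : R) : 0 <= c -> (forall x, rnorm (S x) <= c * rnorm x) ->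
  (opnorm S <= c%:E)%E.
Proof.
move=> c0 h; apply: ge_ereal_sup => _ [x /= x1 <-].
by rewrite lee_fin (le_trans (h x))// ler_piMr.
Qed.

Lemma opnorm_fin S : opnorm S \is a fin_num.
Proof.
have [c c0 /(opnorm_le c0) h] := operator_bounded S.
by rewrite ge0_fin_numE ?opnorm_ge0// (le_lt_trans h)// ltry.
Qed.

Lemma operatorD S x y : S (x + y) = S x + S y. Proof. exact: linearD. Qed.
Lemma operatorB S x y : S (x - y) = S x - S y. Proof. exact: linearB. Qed.
Lemma operatorZ S a x : S (a *: x) = a *: S x. Proof. exact: linearZ. Qed.
Lemma operatorMn S x n : S (x *+ n) = S x *+ n. Proof. exact: raddfMn. Qed.
Lemma operator0 S : S 0 = 0. Proof. exact: linear0. Qed.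

Definition ropnorm S : R := fine (opnorm S).

Lemma ropnormE S : opnorm S = (ropnorm S)%:E.
Proof. by rewrite fineK// opnorm_fin. Qed.

Lemma ropnorm_ge0 S : 0 <= ropnorm S.
Proof. by rewrite -lee_fin -ropnormE opnorm_ge0. Qed.

Lemma ropnorm_le S (c : R) : 0 <= c -> (forall x, rnorm (S x) <= c * rnorm x) ->
  ropnorm S <= c.
Proof. by move=> c0 h; rewrite -lee_fin -ropnormE opnorm_le. Qed.

Lemma operator_le_ropnorm S x : rnorm (S x) <= ropnorm S * rnorm x.
Proof.
have [x0|x0] := eqVneq (rnorm x) 0.
  by rewrite (rnorm_eq0 x0) linear0 !rnorm0 mulr0.
have xp : 0 < rnorm x by rewrite lt0r x0 rnorm_ge0.
rewrite -ler_pdivrMr// -lee_fin -ropnormE.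
apply: ereal_sup_ubound; exists (scalar_of k (rnorm x)^-1 *: x) => /=.
  by rewrite rnormZr ger0_norm ?invr_ge0 ?rnorm_ge0// mulVf.
by rewrite linearZ rnormZr ger0_norm ?invr_ge0 ?rnorm_ge0// mulrC.
Qed.

End operator_norm.

Section operator_eval.
Context {R : realType} {k : scalar_kind}.
Context {X Y : normedModType (scalar_field R k)}.
Implicit Types S U : operator X Y.
Lemma operator_ext S U : S =1 U -> S = U.
Proof. by move=> SU; apply/val_inj/funext. Qed.
Lemma operator_addE S U x : (S + U) x = S x + U x. Proof. by []. Qed.
Lemma operator_oppE S x : (- S) x = - S x. Proof. by []. Qed.
Lemma operator_zeroE x : (0 : operator X Y) x = 0. Proof. by []. Qed.
Lemma operator_sumE (I : Type) (r : seq I) (P : pred I) (S : I -> operator X Y) x :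
  (\sum_(i <- r | P i) S i) x = \sum_(i <- r | P i) S i x.
Proof.
by elim/big_rec2 : _ => // i y z _ <-.
Qed.
End operator_eval.

Section operator_norm_theory.
Context {R : realType} {k : scalar_kind} {X Y : normedModType (scalar_field R k)}.
Lemma ropnorm_small0 (S : operator X Y) :
  (forall e : R, 0 < e -> ropnorm S <= e) -> S = 0.
Proof.
move=> h; apply: operator_ext => x; apply: rnorm_eq0; apply/eqP.
rewrite eq_le rnorm_ge0 andbT (le_trans (operator_le_ropnorm S x))//.
have -> : ropnorm S = 0.
  apply/eqP; rewrite eq_le ropnorm_ge0 andbT; apply/ler_addgt0Pr => e e0.
  by rewrite add0r h.
by rewrite mul0r.
Qed.

Lemma ropnormD (S T : operator X Y) : ropnorm (S + T) <= ropnorm S + ropnorm T.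
Proof.
apply: ropnorm_le; first by rewrite addr_ge0 ?ropnorm_ge0.
move=> x; rewrite operator_addE mulrDl (le_trans (rnormD _ _))// lerD// operator_le_ropnorm//.
Qed.

Lemma ropnormN (S : operator X Y) : ropnorm (- S) = ropnorm S.
Proof.
have h (T : operator X Y) : ropnorm (- T) <= ropnorm T.
  apply: ropnorm_le; first exact: ropnorm_ge0.
  by move=> x; rewrite operator_oppE rnormN operator_le_ropnorm.
by apply/eqP; rewrite eq_le h/= -[X in ropnorm X <= _]opprK h.
Qed.

Lemma cvg_opnorm0 (S : nat -> operator X Y) : opnorm (S n) @[n --> \oo] --> 0%E ->
  forall e : R, 0 < e -> \forall n \near \oo, ropnorm (S n) < e.
Proof.
move=> /fine_cvgP[_ /cvgrPdist_lt h] e e0; apply: filterS (h e e0) => n hn.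
by apply: le_lt_trans hn; rewrite sub0r normrN; exact: ler_norm.
Qed.
End operator_norm_theory.

(** * Borel sets and tight contents *)

Section borel_sets.
Context {Omega : topologicalType}.
Implicit Types A B : set Omega.

Lemma borel_open A : open A -> borel A.
Proof. exact: sub_sigma_algebra. Qed.
Lemma borel0 : borel (set0 : set Omega). Proof. exact: sigma_algebra0. Qed.
Lemma borelC A : borel A -> borel (~` A).
Proof. by move=> bA; rewrite -setTD; exact: sigma_algebraCD. Qed.
Lemma borel_bigcup (A : nat -> set Omega) :
  (forall i, borel (A i)) -> borel (\bigcup_i A i).
Proof. exact: sigma_algebra_bigcup. Qed.
Lemma borelU A B : borel A -> borel B -> borel (A `|` B).
Proof.
move=> bA bB; rewrite -bigcup2E; by apply: borel_bigcup => -[|[|i]] //=; exact: borel0.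
Qed.
Lemma borelI A B : borel A -> borel B -> borel (A `&` B).
Proof.
move=> bA bB; rewrite -(setCK A) -(setCK B) -setCU.
by apply: borelC; apply: borelU; apply: borelC.
Qed.
Lemma borelD A B : borel A -> borel B -> borel (A `\` B).
Proof. by move=> bA bB; rewrite setDE; apply: borelI => //; apply: borelC. Qed.
Lemma borel_closed A : closed A -> borel A.
Proof.
move=> cA; rewrite -(setCK A); apply: borelC; apply: borel_open.
exact: closed_openC.
Qed.
End borel_sets.

Section tight_contents.
Context {R : realType} {Omega : topologicalType} (cO : compact [set: Omega]).

(** An abstract substitute for the variation of a functional. Tightness is inner
    regularity stated with the content of a difference instead of a difference of
    contents, a form that passes to infinite weighted sums. *)
Record tight_content (v : set Omega -> R) : Prop := TightContent {
  content_ge0 : forall U, 0 <= v U;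
  content_mono : forall U V, open U -> open V -> U `<=` V -> v U <= v V;
  contentU : forall U V, open U -> open V -> v (U `|` V) <= v U + v V;
  content_tight : forall U, open U -> forall e, 0 < e ->
    exists2 S, closed S /\ S `<=` U & v (U `\` S) <= e }.

Lemma closed_compactT (S : set Omega) : closed S -> compact S.
Proof. by move=> cS; apply: subclosed_compact cS cO _. Qed.

Lemma openD (U S : set Omega) : open U -> closed S -> open (U `\` S).
Proof. by move=> oU cS; rewrite setDE; apply: openI => //; exact: closed_openC. Qed.

Lemma open_bigsetU (U : nat -> set Omega) n : (forall i, open (U i)) ->
  open (\big[setU/set0]_(i < n) U i).
Proof. by move=> oU; elim/big_ind: _ => //; [exact: open0|exact: openU]. Qed.

Lemma closed_bigsetU (U : nat -> set Omega) n : (forall i, closed (U i)) ->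
  closed (\big[setU/set0]_(i < n) U i).
Proof. by move=> oU; elim/big_ind: _ => //; [exact: closed0|exact: closedU]. Qed.

(** Otherwise the sets S minus a finite union would generate a proper filter, and a
    cluster point of it in S would belong to no U i. *)
Lemma closed_sub_bigcup (S : set Omega) (U : nat -> set Omega) :
  closed S -> (forall i, open (U i)) -> S `<=` \bigcup_i U i ->
  exists n, S `<=` \big[setU/set0]_(i < n) U i.
Proof.
move=> /closed_compactT cS oU SU; apply: contrapT => /forallNP h.
pose D n := S `\` \big[setU/set0]_(i < n) U i.
have D_proper : ProperFilter (filter_from setT D).
  apply: filter_from_proper; last first.
    by move=> n _; have /existsNP[t /not_implyP[St Ut]] := h n; exists t.
  apply: filter_from_filter; first by exists 0%N.
  move=> m n _ _; exists (maxn m n) => // t [St].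
  rewrite -bigcup_mkord => Ut.
  by split; split=> //; rewrite -bigcup_mkord => -[i /= ilt Uit]; apply: Ut;
    exists i => //=; rewrite leq_max ilt ?orbT.
have [|t [St Dt]] := cS _ D_proper; first by exists 0%N => // t [].
have [i _ Ut] := SU _ St.
have [||u [[_ nUu] Uu]] := Dt (D i.+1) (U i).
- by exists i.+1.
- exact: open_nbhs_nbhs.
by apply: nUu; rewrite -bigcup_mkord; exists i => /=.
Qed.

Section tight.
Variables (v : set Omega -> R) (tv : tight_content v).

Lemma content0 : v set0 = 0.
Proof.
apply/eqP; rewrite eq_le content_ge0// andbT; apply/ler_addgt0Pl => e e0.
have [S _] := content_tight tv open0 e0.
by rewrite set0D addr0.
Qed.

Lemma content_bigsetU (U : nat -> set Omega) n : (forall i, open (U i)) ->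
  v (\big[setU/set0]_(i < n) U i) <= \sum_(i < n) v (U i).
Proof.
move=> oU; elim: n => [|n IH]; first by rewrite !big_ord0 content0.
rewrite !big_ord_recr /=; apply: le_trans (contentU tv _ _) _ => //.
  exact: open_bigsetU.
by rewrite lerD2r.
Qed.

Definition approximable (B : set Omega) := forall e : R, 0 < e ->
  exists C U, [/\ closed C, open U, C `<=` B, B `<=` U & v (U `\` C) <= e].

(** The approximable sets form a sigma-algebra containing the open sets. The
    delicate case is a countable union: by tightness, the union of the open sets
    U i agrees, up to content e / 2, with a closed set, and compactness covers that
    set by finitely many of them, so that finitely many of the C i suffice. *)
Lemma borel_approximable B : borel B -> approximable B.
Proof.
apply: (@smallest_sub _ _ _ [set B | approximable B]); last first.
  move=> U oU e e0; have [S [cS SU] vS] := content_tight tv oU e0.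
  by exists S, U; split.
split => /=.
- move=> e e0; exists set0, set0; split => //; [exact: closed0|exact: open0|].
  by rewrite setDv content0 ltW.
- move=> A hA e e0; have [C [U [cC oU CA AU vCU]]] := hA e e0.
  exists (~` U), (~` C); rewrite setTD; split.
  + exact: open_closedC.
  + exact: closed_openC.
  + exact: subsetC.
  + exact: subsetC.
  + by rewrite setDE setCK setIC -setDE.
move=> A hA e e0.
have e2 : 0 < e / 2 by rewrite divr_gt0.
have ei i : 0 < e / 2 / (2 ^ i.+1)%:R by rewrite divr_gt0// ltr0n expn_gt0.
have /choice[C /choice[U hU]] i := hA i _ (ei i).
have oU i : open (U i) by have [] := hU i.
have cC i : closed (C i) by have [] := hU i.
have oUU : open (\bigcup_i U i) by exact: bigcup_open.
have [S [cS SU] vS] := content_tight tv oUU e2.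
have [n Sn] := closed_sub_bigcup cS oU SU.
have oD i : open (U i `\` C i) by exact: openD.
exists (\big[setU/set0]_(i < n) C i), (\bigcup_i U i); split => //.
- exact: closed_bigsetU.
- rewrite -bigcup_mkord => t [i _ Ct]; exists i => //.
  by have [_ _ + _ _] := hU i; apply.
- by apply: subset_bigcup => i _; have [] := hU i.
apply: (@le_trans _ _ (v ((\bigcup_i U i `\` S) `|`
    \big[setU/set0]_(i < n) (U i `\` C i)))).
  apply: content_mono => //.
  + by apply: openD => //; apply: closed_bigsetU.
  + by apply: openU; [exact: openD|exact: (open_bigsetU n oD)].
  rewrite -bigcup_mkord -(bigcup_mkord n (fun i => U i `\` C i)) => t [Ut nCt].
  have [St|St] := pselect (S t); last by left; split.
  right; have := Sn _ St; rewrite -bigcup_mkord => -[i /= ilt Uit].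
  by exists i => //; split => // Cit; apply: nCt; exists i.
apply: le_trans (contentU tv _ _) _ => //.
- exact: openD.
- exact: (open_bigsetU n oD).
rewrite [leRHS](splitr e) lerD// (le_trans (content_bigsetU _ oD))//.
apply: le_trans (geo_half_le n e2); apply: ler_sum => i _.
by have [] := hU i.
Qed.

End tight.
End tight_contents.

(** * Continuous functions and the content of a functional *)

Section continuous_functions.
Context {R : realType} {k : scalar_kind} {Omega : topologicalType}.
Context {cO : compact [set: Omega]} {E : normedModType (scalar_field R k)}.
Local Notation K := (scalar_field R k).
Local Notation Kn := (K^o : normedModType K).
Local Notation C := (cfun cO E).
Implicit Types (f g : C) (U V : set Omega) (l : dual_space C).

Definition scale_cfun (phi : Omega -> R) (cphi : continuous phi) f : C :=
  mkcts (continuous_scale cphi (@cts_fun _ _ f)).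

Definition cst_cfun (e : E) : C := @cst Omega E e.

Lemma rnorm_cfun f : rnorm f = cfun_supnorm f.
Proof. exact: scalar_ofK. Qed.

Lemma rnorm_cfun_le f (r : R) : 0 <= r -> (forall t, rnorm (f t) <= r) -> rnorm f <= r.
Proof. by rewrite rnorm_cfun; exact: cfun_supnorm_le. Qed.

Lemma cfun_le_rnorm f t : rnorm (f t) <= rnorm f.
Proof. by rewrite rnorm_cfun; exact: cfun_supnorm_ge. Qed.

Lemma urysohn_closed_open (hO : hausdorff_space Omega) (S U : set Omega) :
  closed S -> open U -> S `<=` U -> exists phi : Omega -> R,
  [/\ continuous phi, forall t, 0 <= phi t <= 1,
    forall t, S t -> phi t = 1 & forall t, ~ U t -> phi t = 0].
Proof.
move=> cS oU SU.
have US : ~` U `&` S = set0 by rewrite -subset0 => t [Ut /SU].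
have /(@uniform_separatorP _ R)[phi [cphi phi01 phi0 phi1]] :=
  normal_uniform_separator (compact_normal hO cO) (open_closedC oU) cS US.
exists phi; split => //.
- by move=> t; have := phi01 (phi t) (imageT _ _); rewrite /= in_itv.
- by move=> t St; apply: phi1; exists t.
- by move=> t Ut; apply: phi0; exists t.
Qed.

(** The radial retraction onto the ball of radius d. The difference of f and its
    truncation is a soft thresholding of f: it vanishes where f is small. *)
Lemma truncation f (d : R) : 0 < d -> exists g : C,
  [/\ forall t, rnorm (g t) <= d, forall t, rnorm (f t) <= d -> g t = f t &
      forall t, rnorm (f t - g t) <= rnorm (f t)].
Proof.
move=> d0; pose phi t := d / Num.max d (rnorm (f t)).
have m0 t : 0 < Num.max d (rnorm (f t)) by rewrite lt_max d0.
have cphi : continuous phi.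
  move=> t; apply: cvgM; first exact: cvg_cst.
  apply: cvgV; first by rewrite gt_eqF.
  apply: (@continuous_max _ _ (cst d) (fun t => rnorm (f t))); first exact: cvg_cst.
  exact: (continuous_comp (@cts_fun _ _ f t) (@rnorm_continuous R k E (f t))).
have phi0 t : 0 <= phi t by rewrite divr_ge0 ?ltW.
have phi1 t : phi t <= 1 by rewrite ler_pdivrMr// mul1r le_max lexx.
exists (scale_cfun cphi f); split => t.
- rewrite /= /mkcts rnormZr ger0_norm// mulrAC ler_pdivrMr// ler_wpM2l ?(ltW d0)//.
  by rewrite le_max lexx orbT.
- move=> ftd; rewrite /= /mkcts /phi max_l// divff ?gt_eqF//.
  by rewrite scalar_of1 scale1r.
- rewrite /= /mkcts.
  have -> : f t - scalar_of k (phi t) *: f t = scalar_of k (1 - phi t) *: f t.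
    by rewrite -[X in X - _]scale1r -scalerBl scalar_ofB scalar_of1.
  by rewrite rnormZr ger0_norm ?subr_ge0// ler_piMl ?rnorm_ge0// gerBl.
Qed.

(** The estimate that the total variation measure of l satisfies. *)
Definition dominated l (v : set Omega -> R) := forall f U (M : R), open U -> 0 <= M ->
  (forall t, ~ U t -> f t = 0) -> (forall t, rnorm (f t) <= M) ->
  rnorm (l f : Kn) <= M * v U.

Definition unit_supported U : set C :=
  [set f | (forall t, rnorm (f t) <= 1) /\ (forall t, ~ U t -> f t = 0)].

Definition content_of l U : R :=
  sup [set rnorm (l f : Kn) | f in unit_supported U].

Lemma unit_supported0 U : unit_supported U 0.
Proof. by split => t; rewrite cfun0E ?rnorm0. Qed.

Lemma unit_supportedS U V : U `<=` V -> unit_supported U `<=` unit_supported V.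
Proof. by move=> UV f [f1 fU]; split => // t Vt; apply: fU => /UV. Qed.

Lemma content_of_ub l U f : unit_supported U f -> rnorm (l f : Kn) <= ropnorm l.
Proof.
move=> [f1 _]; apply: le_trans (operator_le_ropnorm l f) _.
by rewrite ler_piMr ?ropnorm_ge0// rnorm_cfun_le.
Qed.

Lemma content_of_ge l U f : unit_supported U f -> rnorm (l f : Kn) <= content_of l U.
Proof.
move=> Uf; apply: ub_le_sup; last by exists f.
by exists (ropnorm l) => _ [g Ug <-]; exact: content_of_ub Ug.
Qed.

Lemma content_of_le l U (r : R) :
  (forall f, unit_supported U f -> rnorm (l f : Kn) <= r) -> content_of l U <= r.
Proof.
move=> h; apply: ge_sup; last by move=> _ [f Uf <-]; exact: h.
by exists (rnorm (l 0 : Kn)), 0 => //; exact: unit_supported0.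
Qed.

Lemma content_of_ropnorm l U : content_of l U <= ropnorm l.
Proof. by apply: content_of_le => f; exact: content_of_ub. Qed.

Lemma content_of_dominated l : dominated l (content_of l).
Proof.
move=> f U M oU M0 fU fM.
have [M00|Mn0] := eqVneq M 0.
  suff -> : f = 0 by rewrite operator0 rnorm0 M00 mul0r.
  apply: cfunP => t; rewrite cfun0E; apply: rnorm_eq0; apply/eqP.
  by rewrite eq_le rnorm_ge0 andbT -M00.
have Mp : 0 < M by rewrite lt0r Mn0.
rewrite mulrC -ler_pdivrMr//.
have := @content_of_ge l U (scalar_of k M^-1 *: f).
rewrite operatorZ rnormZr ger0_norm ?invr_ge0// mulrC; apply.
split => t; rewrite cfunZE ?rnormZr ?ger0_norm ?invr_ge0//.
  by rewrite mulrC ler_pdivrMr// mul1r.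
by move=> /fU ->; rewrite scaler0.
Qed.

(** A soft thresholding of f at a small level is uniformly close to f, and vanishes
    off the closed set where the norm of f reaches that level. *)
Lemma shrink_support l U f (e : R) : 0 < e -> open U -> unit_supported U f ->
  exists g S, [/\ closed S, S `<=` U, unit_supported S g &
    rnorm (l f - l g : Kn) <= e].
Proof.
move=> e0 oU [f1 fU].
have L0 : 0 < ropnorm l + 1 by rewrite ltr_wpDl ?ropnorm_ge0.
pose d := Num.min (e / (ropnorm l + 1)) (1/2).
have d0 : 0 < d by rewrite lt_min !divr_gt0.
have [g [gd gf fg]] := truncation f d0.
exists (f - g), [set t | d <= rnorm (f t)]; split.
- apply: (@closed_comp _ _ (fun t => rnorm (f t)) [set x | d <= x]).
    move=> t _; exact: (continuous_comp (@cts_fun _ _ f t) (@rnorm_continuous R k E (f t))).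
  exact: closed_ge.
- move=> t /= dt; apply: contrapT => /fU ft0.
  by move: dt; rewrite ft0 rnorm0 leNgt d0.
- split => t; first by rewrite cfunDE cfunNE (le_trans (fg t)).
  move=> /negP; rewrite -ltNge => /ltW/gf; rewrite cfunDE cfunNE => ->.
  by rewrite subrr.
- rewrite operatorB opprB addrCA subrr addr0.
  apply: le_trans (operator_le_ropnorm l g) _.
  apply: (@le_trans _ _ (ropnorm l * d)).
    by rewrite ler_wpM2l ?ropnorm_ge0// rnorm_cfun_le// ltW.
  apply: (@le_trans _ _ ((ropnorm l + 1) * (e / (ropnorm l + 1)))).
    by rewrite ler_pM ?ropnorm_ge0 ?(ltW d0)// ?lerDl// ge_min lexx.
  by rewrite mulrCA divff ?mulr1 ?gt_eqF.
Qed.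

Lemma rotate_functional l f : exists u : K, `|u| = 1 /\
   l (u *: f) = scalar_of k (rnorm (l f : Kn)).
Proof.
have [u u1 ul] := rotation (l f); exists u; split => //.
by rewrite operatorZ.
Qed.

(** Once f and g are rotated to make their values under l nonnegative, their sum
    still belongs to the unit ball because their supports are disjoint. *)
Lemma content_of_superadd l U V f g : (forall t, U t -> ~ V t) ->
  unit_supported U f -> unit_supported V g ->
  rnorm (l f : Kn) + rnorm (l g : Kn) <= content_of l (U `|` V).
Proof.
move=> UV [f1 fU] [g1 gV].
have [a [a1 af]] := rotate_functional l f.
have [b [b1 bg]] := rotate_functional l g.
have := @content_of_ge l (U `|` V) (a *: f + b *: g).
rewrite operatorD af bg -scalar_ofD rnorm_scalar_of ger0_norm ?addr_ge0 ?rnorm_ge0//.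
apply; split => t; rewrite cfunDE !cfunZE.
  have [Ut|Ut] := pselect (U t).
    by rewrite (gV t) ?scaler0 ?addr0 ?rnormZ1//; exact: UV.
  by rewrite (fU t)// scaler0 add0r rnormZ1.
by move=> /not_orP[Ut Vt]; rewrite fU// gV// !scaler0 addr0.
Qed.

(** Subadditivity: a function with closed support S inside U and V together is cut
    in two by a Urysohn function that is 1 on the part of S outside V and 0 off U.
    Tightness: if g has closed support S and nearly attains the supremum for U,
    then superadditivity leaves almost nothing for functions supported in U minus
    S. *)
Lemma content_of_tight (hO : hausdorff_space Omega) l : tight_content (content_of l).
Proof.
split.
- move=> U; apply: le_trans (content_of_ge l (unit_supported0 U)).
  exact: rnorm_ge0.
- move=> U V _ _ UV; apply: content_of_le => f /(unit_supportedS UV).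
  exact: content_of_ge.
- move=> U V oU oV; apply: content_of_le => f fUV.
  apply/ler_addgt0Pr => e e0.
  have [g [S [cS SUV [g1 gS] lfg]]] := shrink_support l e0 (openU oU oV) fUV.
  have cSV : closed (S `\` V) by rewrite setDE; apply: closedI => //; exact: open_closedC.
  have SVU : S `\` V `<=` U by move=> t [/SUV[]].
  have [phi [cphi phi01 phi1 phi0]] := urysohn_closed_open hO cSV oU SVU.
  pose gU := scale_cfun cphi g.
  have gUE t : gU t = scalar_of k (phi t) *: g t by [].
  have gVE t : (g - gU) t = scalar_of k (1 - phi t) *: g t.
    by rewrite cfunDE cfunNE gUE scalar_ofB scalar_of1 scalerBl scale1r.
  have hU : unit_supported U gU.
    split => t; rewrite gUE; have /andP[p0 p1] := phi01 t.
      by rewrite rnormZr ger0_norm// mulr_ile1// rnorm_ge0.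
    by move=> Ut; rewrite phi0// scalar_of0 scale0r.
  have hV : unit_supported V (g - gU).
    split => t; rewrite gVE; have /andP[p0 p1] := phi01 t.
      by rewrite rnormZr ger0_norm ?subr_ge0// mulr_ile1 ?subr_ge0 ?rnorm_ge0 ?gerBl.
    move=> Vt; have [St|St] := pselect (S t); last by rewrite gS ?scaler0.
    by rewrite phi1// subrr scalar_of0 scale0r.
  have -> : l f = (l f - l g) + (l gU + l (g - gU)).
    by rewrite operatorB [l gU + _]addrC !subrK.
  apply: le_trans (rnormD _ _) _; rewrite addrC lerD//.
  apply: le_trans (rnormD _ _) _; rewrite lerD//; exact: content_of_ge.
- move=> U oU e e0.
  have e2 : 0 < e / 2 by rewrite divr_gt0.
  have [|_ [f Uf <-] lf] :=
      @sup_adherent _ [set rnorm (l f : Kn) | f in unit_supported U] _ e2.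
    split; first by exists (rnorm (l 0 : Kn)), 0 => //; exact: unit_supported0.
    by exists (ropnorm l) => _ [g Ug <-]; exact: content_of_ub Ug.
  have [g [S [cS SU hg lfg]]] := shrink_support l e2 oU Uf.
  exists S => //; apply: content_of_le => h hh.
  have := @content_of_superadd l S (U `\` S) g h _ hg hh.
  rewrite setDUK//.
  have lfg' : rnorm (l f : Kn) <= rnorm (l g : Kn) + e / 2.
    by rewrite -[X in rnorm X](subrK (l g)) addrC (le_trans (rnormD _ _))// lerD2l.
  have : forall t, S t -> ~ (U `\` S) t by move=> t St [].
  move=> SUS /(_ SUS); move: lf lfg'; rewrite -/(content_of l U); lra.
Qed.

End continuous_functions.

(** * The Lusin integral *)

Section lusin.
Context {R : realType} {k : scalar_kind} {Omega : topologicalType}.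
Context {cO : compact [set: Omega]} {E : normedModType (scalar_field R k)}.
Local Notation K := (scalar_field R k).
Local Notation Kn := (K^o : normedModType K).
Local Notation C := (cfun cO E).

(** The value z is the limit of l f over continuous f that agree with s off open
    sets of small content. The common bound M is what makes z unique. *)
Definition lusin_integral (l : dual_space C) (v : set Omega -> R) (s : Omega -> E)
    (z : Kn) := exists M : R, forall e : R, 0 < e -> exists (f : C) (O : set Omega),
  [/\ open O, v O <= e, forall t, ~ O t -> f t = s t, forall t, rnorm (f t) <= M
    & rnorm (z - l f) <= e].

Definition indic_vec (B : set Omega) (e : E) : Omega -> E :=
  fun t => if t \in B then e else 0.

Variables (l : dual_space C) (v : set Omega -> R).
Hypotheses (tv : tight_content v) (lv : dominated l v).
Let lusin := lusin_integral l v.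

Lemma lusin_cfun (f : C) : lusin f (l f).
Proof.
exists (rnorm f) => e e0; exists f, set0; split => //; first exact: open0.
- by rewrite (content0 tv) ltW.
- exact: cfun_le_rnorm.
- by rewrite subrr rnorm0 ltW.
Qed.

Lemma lusin_linear (a : K) s s' (z z' : Kn) : lusin s z -> lusin s' z' ->
  lusin (fun t => a *: s t + s' t) (a *: z + z').
Proof.
move=> [M hM] [M' hM'].
pose c := scalar_re `|a|.
have c0 : 0 <= c by rewrite -(@scalar_re0 R k) scalar_re_le.
exists (c * M + M') => e e0.
pose d := e / (c + 1) / 2.
have c1 : 0 < c + 1 by rewrite ltr_wpDl.
have d0 : 0 < d by rewrite !divr_gt0.
have de : c * d + d <= e.
  rewrite -{2}[d]mul1r -mulrDl /d mulrA mulrCA divff ?gt_eqF// mulr1.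
  by rewrite ler_pdivrMr// ler_pMr// ler1n.
have d2e : d + d <= e.
  rewrite -mulr2n -mulr_natr /d divfK ?pnatr_eq0// ler_pdivrMr//.
  by rewrite ler_peMr ?lerDr// ltW.
have [f [ O [ oO vO fs fM zf]]] := hM _ d0.
have [f' [ O' [ oO' vO' fs' fM' zf']]] := hM' _ d0.
exists (a *: f + f'), (O `|` O'); split.
- exact: openU.
- by apply: le_trans (contentU tv oO oO') _; apply: le_trans d2e; exact: lerD.
- by move=> t /not_orP[Ot Ot1]; rewrite cfunDE cfunZE fs// fs'.
- move=> t; rewrite cfunDE cfunZE (le_trans (rnormD _ _))// rnormZ lerD//.
  by rewrite ler_wpM2l.
- rewrite operatorD operatorZ opprD addrACA -scalerBr.
  apply: le_trans (rnormD _ _) _; rewrite rnormZ; apply: le_trans de.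
  by rewrite lerD// ler_wpM2l.
Qed.

(** Truncating an approximant at level d does not change it off its exceptional
    set, because s is bounded by d there. The truncated function vanishes off O
    and the exceptional set, so domination bounds its value under l. *)
Lemma lusin_bound s z O (d : R) : lusin s z -> open O -> 0 <= d ->
  (forall t, ~ O t -> s t = 0) -> (forall t, rnorm (s t) <= d) ->
  rnorm z <= d * v O.
Proof.
move=> [M hM] oO d0 sO sd.
apply: (@ler_addeps _ _ _ (v O + 1 + `|M| + d + 1)) => e e0.
(* Products of two small quantities occur below; they are at most e1 as e1 <= 1. *)
pose e1 := Num.min e 1.
have e10 : 0 < e1 by rewrite lt_min e0 ltr01.
have e1e : e1 <= e by rewrite ge_min lexx.
have e11 : e1 <= 1 by rewrite ge_min lexx orbT.
have [f [ O' [ oO' vO' fs fM zf]]] := hM _ e10.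
have dp : 0 < d + e1 by rewrite ltr_wpDl.
have [g [gd gf fg]] := truncation f dp.
have gfO' t : ~ O' t -> g t = f t.
  by move=> O't; apply: gf; rewrite fs// (le_trans (sd t))// lerDl ltW.
have h1 : rnorm (l (f - g) : Kn) <= `|M| * v O'.
  apply: lv => // t; rewrite cfunDE cfunNE.
    by move=> /gfO' ->; rewrite subrr.
  by rewrite (le_trans (fg t))// (le_trans (fM t))// ler_norm.
have h2 : rnorm (l g : Kn) <= (d + e1) * v (O `|` O').
  apply: lv => //; [exact: openU|exact: ltW|].
  by move=> t /not_orP[Ot O't]; rewrite gfO'// fs// sO.
have h3 := contentU tv oO oO'.
have -> : z = (z - l f) + (l (f - g) + l g).
  by rewrite operatorB !subrK.
apply: le_trans (rnormD _ _) _.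
have h4 := rnormD (l (f - g) : Kn) (l g : Kn).
have vO0 := content_ge0 tv O.
have h5 : (d + e1) * v (O `|` O') <= (d + e1) * (v O + e1).
  by rewrite ler_pM2l// (le_trans h3)// lerD2l.
have h6 : `|M| * v O' <= `|M| * e1 by rewrite ler_wpM2l.
have h7 : e1 * e1 <= e1 by rewrite ler_piMl// ltW.
apply: (@le_trans _ _ (d * v O + (v O + 1 + `|M| + d + 1) * e1)).
  by move: zf h1 h2 h4 h5 h6 h7; nra.
by rewrite lerD2l ler_wpM2l// !addr_ge0.
Qed.

Lemma lusin_uniq s z z' : lusin s z -> lusin s z' -> z = z'.
Proof.
move=> sz sz'; have := lusin_linear (-1) sz sz'.
move=> /lusin_bound/(_ openT (lexx 0)) h.
apply/esym/eqP; rewrite -subr_eq0 addrC -scaleN1r; apply/eqP/rnorm_eq0.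
apply/eqP; rewrite eq_le rnorm_ge0 andbT -(mul0r (v setT)); apply: h.
  by move=> t /(_ I).
by move=> t; rewrite scaleN1r addNr rnorm0.
Qed.

Lemma lusin0 : lusin (fun=> 0) 0.
Proof. by have := lusin_cfun 0; rewrite operator0. Qed.

Lemma lusin_ext s s' z : s =1 s' -> lusin s z -> lusin s' z.
Proof. by move=> /funext ->. Qed.

Lemma lusin_sum (I : Type) (r : seq I) (s : I -> Omega -> E) (z : I -> Kn) :
  (forall i, lusin (s i) (z i)) ->
  lusin (fun t => \sum_(i <- r) s i t) (\sum_(i <- r) z i).
Proof.
move=> h; elim: r => [|i r IH].
  by rewrite big_nil; apply: lusin_ext lusin0 => t; rewrite big_nil.
rewrite big_cons -[z i]scale1r.
by apply: lusin_ext (lusin_linear 1 (h i) IH) => t; rewrite big_cons scale1r.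
Qed.

Lemma rnorm_indic_vec B e t : rnorm (indic_vec B e t) <= rnorm e.
Proof. by rewrite /indic_vec; case: ifP => // _; rewrite rnorm0 rnorm_ge0. Qed.

(** The bound holds for any f and O of this kind, whatever their origin, so that
    the same f and O can serve for all the terms of a nuclear representation. *)
Lemma lusin_indic_error B (e : E) (f : C) O z : lusin (indic_vec B e) z -> open O ->
  (forall t, ~ O t -> f t = indic_vec B e t) -> (forall t, rnorm (f t) <= rnorm e) ->
  rnorm (z - l f : Kn) <= 2 * rnorm e * v O.
Proof.
move=> hz oO fO fe.
have h := lusin_linear (-1) (lusin_cfun f) hz.
rewrite addrC -scaleN1r; apply: (lusin_bound h oO).
- by rewrite mulr_ge0 ?rnorm_ge0.
- by move=> t Ot; rewrite fO// scaleN1r addNr.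
- move=> t; rewrite scaleN1r (le_trans (rnormD _ _))// rnormN mulr2n mulrDl mul1r.
  by rewrite lerD// rnorm_indic_vec.
Qed.

Hypothesis hO : hausdorff_space Omega.

Lemma indic_vec_approximation B (e : E) (d : R) : borel B -> 0 < d ->
  exists (f : C) (O : set Omega), [/\ open O, v O <= d,
    forall t, ~ O t -> f t = indic_vec B e t & forall t, rnorm (f t) <= rnorm e].
Proof.
move=> bB d0.
have [S [U [cS oU SB BU vSU]]] := borel_approximable cO tv bB d0.
have [phi [cphi phi01 phi1 phi0]] :=
  urysohn_closed_open (R := R) (cO := cO) hO cS oU (subset_trans SB BU).
exists (scale_cfun cphi (cst_cfun e)), (U `\` S); split => //.
- exact: openD.
- move=> t /not_andP[Ut|/contrapT St]; rewrite /= /mkcts /indic_vec.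
    by rewrite phi0// scalar_of0 scale0r memNset// => /BU.
  by rewrite phi1// scalar_of1 scale1r mem_set//; exact: SB.
- move=> t; have /andP[p0 p1] := phi01 t.
  by rewrite /= /mkcts rnormZr ger0_norm// ler_piMl// rnorm_ge0.
Qed.

(** Two approximants differ only on the union of their exceptional sets, so their
    values under l form a Cauchy sequence. *)
Lemma lusin_indic_value B (e : E) : borel B -> exists z, lusin (indic_vec B e) z.
Proof.
move=> bB; have e0 n : 0 < n.+1%:R^-1 :> R by rewrite invr_gt0.
have /choice[f /choice[ O hf]] n := indic_vec_approximation e bB (e0 n).
have fmn m n : rnorm (l (f m) - l (f n) : Kn) <=
    (rnorm e + rnorm e) * (m.+1%:R^-1 + n.+1%:R^-1).
  rewrite -operatorB.
  have [om vm fm fme] := hf m; have [on vn fn fne] := hf n.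
  apply: (@le_trans _ _ ((rnorm e + rnorm e) * v (O m `|` O n))).
    apply: lv => //; first exact: openU.
    - by rewrite addr_ge0 ?rnorm_ge0.
    - by move=> t /not_orP[Om On]; rewrite cfunDE cfunNE fm// fn// subrr.
    - by move=> t; rewrite cfunDE cfunNE (le_trans (rnormD _ _))// rnormN lerD.
  rewrite ler_wpM2l ?addr_ge0 ?rnorm_ge0// (le_trans (contentU tv _ _))//.
  exact: lerD.
have [z hz] : exists z : K, forall d : R, 0 < d ->
    \forall n \near \oo, scalar_re `|z - l (f n)| < d.
  apply: scalar_complete => d d0.
  pose c := rnorm e + rnorm e + 1.
  have c0 : 0 < c by rewrite ltr_wpDl// addr_ge0 ?rnorm_ge0.
  have [|N _ hN] := @invSn_small _ (d / c / 2); first by rewrite !divr_gt0.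
  exists N => m n /hN Nm /hN Nn; apply: le_lt_trans (fmn m n) _.
  apply: (@le_lt_trans _ _ (c * (m.+1%:R^-1 + n.+1%:R^-1))).
    by rewrite ler_wpM2r ?addr_ge0// lerDl.
  rewrite mulrC -ltr_pdivlMr// (splitr (d / c)); exact: ltrD.
exists z, (rnorm e) => d d0; have small := invSn_small d0; have hzd := hz d d0.
near \oo => n; exists (f n), (O n); have [om vm fm fme] := hf n; split => //.
- by apply: le_trans vm _; apply: ltW; near: n; exact: small.
- by apply: ltW; near: n; exact: hzd.
Unshelve. all: by end_near. Qed.

Lemma indic_vec_linear B a e e' t :
  indic_vec B (a *: e + e') t = a *: indic_vec B e t + indic_vec B e' t.
Proof. by rewrite /indic_vec; case: ifP => // _; rewrite scaler0 addr0. Qed.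

Lemma lusin_indic B : borel B ->
  exists Lam : dual_space E, forall e, lusin (indic_vec B e) (Lam e).
Proof.
move=> bB; have /choice[Lam hLam] e := lusin_indic_value e bB.
have lLam : linear Lam.
  move=> a e e'; apply: lusin_uniq (hLam _) _.
  apply: lusin_ext (lusin_linear a (hLam e) (hLam e')) => t.
  by rewrite indic_vec_linear.
have bLam e : rnorm (Lam e) <= v setT * rnorm e.
  rewrite mulrC; apply: lusin_bound (hLam e) _ _ _ _ => //.
  - exact: openT.
  - exact: rnorm_ge0.
  - by move=> t /(_ I).
  - by move=> t; exact: rnorm_indic_vec.
by exists (Operator (bounded_operator lLam bLam)).
Qed.

End lusin.

(** * Measures controlled by a tight content *)

Section content_measure.
Context {R : realType} {Omega : topologicalType}.
Variables (cO : compact [set: Omega]).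
Variables (v : set Omega -> R) (tv : tight_content v).
Variables (V : zmodType) (N : V -> \bar R) (m : set Omega -> V).
Hypothesis Nv : forall D W, borel D -> open W -> D `<=` W ->
  (0 <= N (m D) <= (v W)%:E)%E.

Lemma cvge0_small (u : nat -> \bar R) :
  (forall e : R, 0 < e -> \forall n \near \oo, (0 <= u n <= e%:E)%E) ->
  u @ \oo --> 0%E.
Proof.
move=> h; apply/fine_cvgP; split.
  apply: filterS (h 1 ltr01) => n /andP[u0 u1].
  by rewrite ge0_fin_numE// (le_lt_trans u1)// ltry.
apply/cvgrPdist_le => e e0; apply: filterS (h e e0) => n /andP[u0 u1].
rewrite sub0r normrN ger0_norm ?fine_ge0//.
by rewrite -lee_fin fineK// ge0_fin_numE// (le_lt_trans u1)// ltry.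
Qed.

(** It suffices that the tails D n of the union have small content. Closed sets
    C n inside D n that nearly exhaust them have empty intersection, hence so have
    finitely many of them; then D n is eventually covered by finitely many
    differences U i minus C i. *)
Lemma content_countably_additive :
  (forall B : nat -> set Omega, (forall i, borel (B i)) -> trivIset setT B ->
    forall n, m (\bigcup_i B i) - \sum_(i < n) m (B i) = m (\bigcup_i B (n + i)%N)) ->
  setfun_countably_additive N m.
Proof.
move=> madd B bB tB; apply: cvge0_small => e e0.
pose D n := \bigcup_i B (n + i)%N.
have bD n : borel (D n) by apply: borel_bigcup => i; exact: bB.
have ei i : 0 < e / (2 ^ i.+1)%:R by rewrite divr_gt0// ltr0n expn_gt0.
have /choice[C /choice[U hU]] n := borel_approximable cO tv (bD n) (ei n).
have oU i : open (U i) by have [] := hU i.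
have cC i : closed (C i) by have [] := hU i.
have oD i : open (U i `\` C i) by exact: openD.
(* The tails have empty intersection, so the complements of the C i cover Omega. *)
have [|n hn] := @closed_sub_bigcup _ cO setT (fun i => ~` C i) closedT
    (fun i => closed_openC (cC i)).
  move=> t _; apply: contrapT => nC.
  have Ct i : C i t by apply: contrapT => Cit; apply: nC; exists i.
  have CD i : C i `<=` D i by have [] := hU i.
  have [i _ Bit] := CD _ _ (Ct 0%N).
  have [j _ Bjt] := CD _ _ (Ct i.+1).
  have : (0 + i = i.+1 + j)%N.
    by apply: (tB _ _ I I); exists t.
  by rewrite add0n addSnnS => /eqP; rewrite -[X in X == _]addn0 eqn_add2l.
exists n => // j /= nj; rewrite madd//.
have DW : D j `<=` \big[setU/set0]_(i < n) (U i `\` C i).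
  move=> t [i _ Bt]; have := hn t I.
  rewrite -(bigcup_mkord n (fun i => ~` C i)) => -[a /= an Cat].
  rewrite -(bigcup_mkord n (fun i => U i `\` C i)); exists a => //; split => //.
  have [_ _ _ + _] := hU a; apply.
  by exists (j - a + i)%N => //; rewrite addnA subnKC// ltnW// (leq_trans an).
have /andP[-> Nle] := Nv (bD j) (open_bigsetU n oD) DW.
apply: le_trans Nle _; rewrite lee_fin.
apply: le_trans (content_bigsetU tv n oD) _.
apply: le_trans (geo_half_le n e0); apply: ler_sum => i _.
by have [] := hU i.
Qed.

Lemma content_regular : setfun_regular N m.
Proof.
move=> B bB e e0; have e2 : 0 < e / 2 by rewrite divr_gt0.
have [C [U [cC oU CB BU vCU]]] := borel_approximable cO tv bB e2.
exists C, U; split => //; first exact: closed_compactT.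
move=> A bA AU; have /andP[_ h] := Nv bA (openD oU cC) AU.
apply: le_lt_trans h _; rewrite lte_fin (le_lt_trans vCU)//.
by rewrite ltr_pdivrMr// ltr_pMr// ltr1n.
Qed.
End content_measure.

Section simple.
Context {R : realType} {k : scalar_kind} {Omega : topologicalType}.
Context {cO : compact [set: Omega]} {E : normedModType (scalar_field R k)}.
Local Notation K := (scalar_field R k).
Implicit Types s : Omega -> E.

Lemma simple_function_cst (e : E) : simple_function (fun _ : Omega => e).
Proof.
split.
  by apply: (@sub_finite_set _ _ [set e]) => // _ [t _ <-].
move=> e'; have [->|ee'] := eqVneq e e'.
  rewrite (_ : _ @^-1` _ = setT); last by apply/seteqP; split.
  by apply: borel_open; exact: openT.
rewrite (_ : _ @^-1` _ = set0); first exact: borel0.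
by apply/seteqP; split => // t /= /eqP; rewrite (negbTE ee').
Qed.

Lemma simple_function_if (A : set Omega) (e : E) s : borel A -> simple_function s ->
  simple_function (fun t => if t \in A then e else s t).
Proof.
move=> bA [fs bs]; split.
  apply: (@sub_finite_set _ _ ([set e] `|` range s)); last by rewrite finite_setU.
  by move=> _ [t _ <-]; case: ifP => _; [left|right; exists t].
move=> e'; rewrite (_ : _ @^-1` _ =
    (A `&` (fun=> e) @^-1` [set e']) `|` (s @^-1` [set e'] `\` A)).
  apply: borelU; last exact: borelD.
  by apply: borelI => //; have [_ +] := simple_function_cst e; apply.
apply/seteqP; split => t /=.
  by case: ifPn => [/set_mem At ee'|]; [left|rewrite notin_setE => At ->; right].
by move=> [[At <-]|[<- At]]; [rewrite mem_set|rewrite memNset].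
Qed.

(** Cover the compact range of f by finitely many balls of radius e, and map t to
    the centre of the first ball that contains f t. *)
Lemma simple_approx (f : cfun cO E) (e : R) : 0 < e -> exists2 s,
  simple_function s & forall t, rnorm (f t - s t) <= e.
Proof.
move=> e0; pose W (y : E) := [set x : E | rnorm (y - x) < e].
have cR : continuous (fun x : E => rnorm x) := @rnorm_continuous R k E.
have oW y : open (W y).
  apply: (@open_comp _ _ (fun x => rnorm (y - x)) [set r | r < e]); last exact: open_lt.
  move=> x _; apply: (@continuous_comp _ _ _ (fun x => y - x) (fun x => rnorm x)).
    by apply: cvgB; [exact: cvg_cst|exact: cvg_id].
  exact: cR.
have : compact (f @` [set: Omega]).
  by apply: continuous_compact => //; apply: continuous_subspaceT; exact: cts_fun.
rewrite compact_cover => /(_ E setT W)[//||D _ Dcov].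
  by move=> x _; exists x => //=; rewrite /W/= subrr rnorm0.
suff [s ss hs] : exists2 s, simple_function s & forall t,
    (exists2 y, y \in finmap.enum_fset D & rnorm (y - f t) < e) ->
    rnorm (f t - s t) <= e.
  exists s => // t; apply: hs; have [|y /= yD Wy] := Dcov (f t); first by exists t.
  by exists y.
elim: (finmap.enum_fset D) => [|y r [s ss hs]].
  by exists (fun=> 0) => [|t [] //]; exact: simple_function_cst.
have bA : borel (f @^-1` W y).
  apply: borel_open; apply: open_comp => // t _; exact: cts_fun.
exists (fun t => if t \in f @^-1` W y then y else s t).
  exact: simple_function_if.
move=> t [y'].
case: ifPn => [/set_mem/ltW + _ _|]; first by rewrite -rnormN opprB.
rewrite notin_setE => nW; rewrite in_cons => /orP[/eqP -> //|y'r h].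
by apply: hs; exists y'.
Qed.

End simple.

Lemma uniform_cvg_rnormP (R : realType) (k : scalar_kind) (T : choiceType)
    (E : normedModType (scalar_field R k)) (s : nat -> T -> E) (f : T -> E) :
  {uniform, s @ \oo --> f} <->
  forall e : R, 0 < e -> \forall n \near \oo, forall t, rnorm (f t - s n t) < e.
Proof.
split => [h e e0|h].
  have : nbhs (f : {uniform T -> E}) [set g : T -> E | forall t, rnorm (f t - g t) < e].
    apply/uniform_nbhs; exists [set xy | ball xy.1 (scalar_of k e) xy.2]; split.
      by rewrite -entourage_ballE; exists (scalar_of k e) => //=; exact: scalar_of_gt0.
    move=> g /= hg t; have := hg t I.
    by rewrite -ball_normE /ball_ /= -rnorm_lt.
  by move=> /h.
move=> P /uniform_nbhs[A [entA AP]].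
move: entA; rewrite -entourage_ballE => -[_ /= /gt0_scalar_of[e e0 <-] eA].
apply: filterS (h e e0) => n hn; apply: AP => t _; apply: eA => /=.
by rewrite -ball_normE /ball_ /= -rnorm_lt.
Qed.

Section singer.
Context {R : realType} {k : scalar_kind} {Omega : topologicalType}.
Context {cO : compact [set: Omega]} {E : normedModType (scalar_field R k)}.
Local Notation K := (scalar_field R k).
Local Notation Kn := (K^o : normedModType K).
Local Notation C := (cfun cO E).
Variables (l : dual_space C) (v : set Omega -> R).
Hypotheses (tv : tight_content v) (lv : dominated l v).
Local Notation lusin := (lusin_integral l v).
Variable lam : set Omega -> dual_space E.
Hypothesis hlam : forall B e, borel B -> lusin (indic_vec B e) (lam B e).

Lemma lusin_measure_small D W : borel D -> open W -> D `<=` W ->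
  (0 <= opnorm (lam D) <= (v W)%:E)%E.
Proof.
move=> bD oW DW; rewrite opnorm_ge0/=; apply: opnorm_le.
  exact: content_ge0.
move=> e; rewrite mulrC.
apply: (lusin_bound tv lv (hlam e bD) oW (rnorm_ge0 e)) => t.
  by move=> Wt; rewrite /indic_vec memNset// => /DW.
exact: rnorm_indic_vec.
Qed.

Lemma lusin_measure_additive (B : nat -> set Omega) : (forall i, borel (B i)) ->
  trivIset setT B ->
  forall n, lam (\bigcup_i B i) - \sum_(i < n) lam (B i) = lam (\bigcup_i B (n + i)%N).
Proof.
move=> bB tB n; apply/eqP; rewrite subr_eq; apply/eqP/operator_ext => e.
have bU : borel (\bigcup_i B i) by exact: borel_bigcup.
have bUn : borel (\bigcup_i B (n + i)%N) by apply: borel_bigcup.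
apply: (lusin_uniq tv lv (hlam e bU)).
have h := lusin_sum tv (index_enum 'I_n) (fun i : 'I_n => hlam e (bB i)).
have := lusin_linear tv 1 (hlam e bUn) h.
rewrite operator_addE operator_sumE scale1r; apply: lusin_ext => t.
rewrite scale1r /indic_vec.
have [[i _ Bit]|nB] := pselect ((\bigcup_i B i) t); last first.
  rewrite (memNset nB) memNset; last by move=> -[i _ Bt]; apply: nB; exists (n + i)%N.
  rewrite big1 ?addr0// => i _; rewrite memNset// => Bt; apply: nB; by exists i.
rewrite [in RHS]mem_set; last by exists i.
have Bj j : B j t -> j = i by move=> Bt; apply: (tB _ _ I I); exists t.
have [ni|ni] := leqP n i.
  rewrite mem_set; last by exists (i - n)%N => //; rewrite subnKC.
  rewrite big1 ?addr0// => j _; rewrite memNset// => /Bj ji.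
  by have := ltn_ord j; rewrite ji ltnNge ni.
rewrite memNset; last by move=> -[j _ /Bj ij]; move: ni; rewrite -ij ltnNge leq_addr.
rewrite (bigD1 (Ordinal ni))//= mem_set// add0r big1 ?addr0// => j ji.
rewrite memNset// => /Bj jE; move/eqP: ji; apply; exact: val_inj.
Qed.

(** Choose e i in the unit ball that nearly attains the norm of lam (P i), rotated
    so that lam (P i) (e i) is nonnegative. The sum of the norms is then nearly the
    integral of one function with values in the unit ball. *)
Lemma lusin_measure_variation n (P : 'I_n -> set Omega) : borel_partition P ->
  (\sum_(i < n) opnorm (lam (P i)) <= (v setT)%:E)%E.
Proof.
move=> [bP tP _].
under eq_bigr do rewrite ropnormE.
rewrite sumEFin lee_fin; apply: (@ler_addeps _ _ _ n%:R) => d d0.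
have he i : exists e : E, rnorm e <= 1 /\ exists r : R,
    [/\ lam (P i) e = scalar_of k r, 0 <= r & ropnorm (lam (P i)) <= r + d].
  have : ((ropnorm (lam (P i)) - d)%R%:E < opnorm (lam (P i)))%E.
    by rewrite ropnormE lte_fin gtrBl.
  move=> /ereal_sup_gt[_ [x /= x1 <-]]; rewrite lte_fin => hx.
  have [u u1 ul] := rotation (lam (P i) x).
  exists (u *: x); split; first by rewrite rnormZ1.
  exists (rnorm (lam (P i) x)); split; first by rewrite operatorZ.
    exact: rnorm_ge0.
  by rewrite -lerBlDr ltW.
have /choice[e he'] := he.
have /choice[r hr] : forall i, exists r : R,
    [/\ lam (P i) (e i) = scalar_of k r, 0 <= r & ropnorm (lam (P i)) <= r + d].
  by move=> i; have [_ []] := he' i => r ?; exists r.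
have h := lusin_sum tv (index_enum 'I_n) (fun i : 'I_n => hlam (e i) (bP i)).
have := lusin_bound tv lv h openT ler01.
rewrite mul1r (eq_bigr (fun i => scalar_of k (r i))); last by move=> i _; have [] := hr i.
have -> : \sum_(i < n) scalar_of k (r i) = scalar_of k (\sum_(i < n) r i) :> K.
  elim/big_rec2 : _; first by rewrite scalar_of0.
  by move=> i y z _ ->; rewrite scalar_ofD.
rewrite rnorm_scalar_of ger0_norm; last by apply: sumr_ge0 => i _; have [] := hr i.
move=> hv; apply: (@le_trans _ _ (\sum_(i < n) (r i + d))).
  by apply: ler_sum => i _; have [] := hr i.
rewrite big_split/= sumr_const card_ord -[d *+ n]mulr_natl lerD2r; apply: hv.
  by move=> t /(_ I).
move=> t; have [[i Pit]|nP] := pselect (exists i, P i t); last first.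
  rewrite big1 ?rnorm0// => i _; rewrite /indic_vec memNset// => Pit; apply: nP; by exists i.
rewrite (bigD1 i)//= big1 ?addr0.
  by apply: le_trans (rnorm_indic_vec _ _ _) _; have [] := he' i.
move=> j ji; rewrite /indic_vec memNset// => Pjt; move/eqP: ji; apply.
by apply: (tP _ _ I I); exists t.
Qed.

Lemma lusin_simple (s : Omega -> E) : simple_function s ->
  lusin s (simple_integral lam s).
Proof.
move=> [/finite_seqP[r0 r0E] bs]; pose r := undup r0.
have ur : uniq r := undup_uniq r0.
have rE : range s = [set` r] by rewrite r0E; apply/seteqP; split => e /=; rewrite mem_undup.
rewrite /simple_integral rE -fsbig_seq//.
have := lusin_sum tv r (fun e => hlam e (bs e)).
apply: lusin_ext => t.
have st : s t \in r by have : range s (s t) by [exists t]; rewrite rE.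
rewrite (bigD1_seq (s t) st ur)/=.
rewrite /indic_vec mem_set//= big1 ?addr0// => e es.
by rewrite memNset// => /= /esym/eqP; rewrite (negbTE es).
Qed.

(** Integrals of simple functions and values of l are both Lusin integrals, so
    [lusin_bound] turns uniform convergence into convergence of integrals. *)
Lemma lusin_measure_represents : represents lam l.
Proof.
move=> f.
have e0 n : 0 < n.+1%:R^-1 :> R by rewrite invr_gt0.
have /choice[s hs] n : exists s, simple_function s /\ forall t, rnorm (f t - s t) <= n.+1%:R^-1.
  by have [s ? ?] := simple_approx f (e0 n); exists s.
exists s; split; first by move=> n; have [] := hs n.
  apply/uniform_cvg_rnormP => e ep; apply: filterS (invSn_small ep) => n hn t.
  by have [_ fs] := hs n; apply: le_lt_trans (fs t) hn.
apply/(@cvg_rnormP R k Kn) => e ep.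
have hn n : rnorm (l f - simple_integral lam (s n) : Kn) <= n.+1%:R^-1 * v setT.
  have [ss fs] := hs n.
  have h := lusin_linear tv (-1) (lusin_simple ss) (lusin_cfun l tv f).
  rewrite addrC -scaleN1r.
  apply: lusin_bound h openT _ _ _ => //.
    by move=> t /(_ I).
  by move=> t; rewrite scaleN1r addrC.
have vp : 0 < v setT + 1 by rewrite ltr_wpDl// content_ge0.
have ev : 0 < e / (v setT + 1) by rewrite divr_gt0.
apply: filterS (invSn_small ev) => n; rewrite ltr_pdivlMr// => h.
apply: le_lt_trans (hn n) _; apply: le_lt_trans h.
by rewrite ler_wpM2l// lerDl.
Qed.

End singer.

(** * Finite additivity and integrals of simple functions *)

Section fibers.
Context {Omega : topologicalType} {Y : eqType}.
Variables (t : Omega -> Y) (bt : forall y, borel (t @^-1` [set y])).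

Lemma borel_fibers (r : seq Y) : borel [set x | t x \in r].
Proof.
elim: r => [|z q hq].
  by rewrite (_ : [set x | _] = set0); [exact: borel0|apply/seteqP; split].
rewrite (_ : [set x | _] = t @^-1` [set z] `|` [set x | t x \in q]).
  exact: borelU.
apply/seteqP; split => x /=; rewrite inE.
  by move=> /orP[/eqP|]; [left|right].
by move=> [->|->]; rewrite ?eqxx ?orbT.
Qed.

Lemma simple_function_fibers (R : realType) (k : scalar_kind)
    (E : normedModType (scalar_field R k)) (r : seq Y) (phi : Y -> E) :
  (forall x, t x \in r) -> simple_function (phi \o t).
Proof.
move=> tr; split.
  apply: (@sub_finite_set _ _ [set` map phi r]); last by apply/finite_seqP; exists (map phi r).
  by move=> _ [w _ <-] /=; apply: map_f; exact: tr.
move=> e.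
rewrite (_ : _ @^-1` _ = [set x | t x \in [seq y <- r | phi y == e]]).
  exact: borel_fibers.
apply/seteqP; split => x /=; rewrite mem_filter tr andbT.
  by move=> ->.
by move/eqP.
Qed.
End fibers.

Section finite_additivity.
Context {R : realType} {k : scalar_kind} {Omega : topologicalType}.
Context {E : normedModType (scalar_field R k)}.
Local Notation K := (scalar_field R k).
Local Notation Kn := (K^o : normedModType K).
Variable lam : set Omega -> dual_space E.
Hypothesis lam_ca : setfun_countably_additive opnorm lam.

(** Along the constant sequence of empty sets, two consecutive differences in
    countable additivity differ by lam set0. *)
Lemma measure_set0 : lam set0 = 0.
Proof.
have h : trivIset setT (fun _ : nat => set0 : set Omega) by move=> i j _ _ [t []].
have /cvg_opnorm0 hc := lam_ca (fun _ => borel0) h.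
apply: ropnorm_small0 => e e0.
have e2 : 0 < e / 2 by rewrite divr_gt0.
have [N _ hN] := hc _ e2.
have h1 := hN N (leqnn N); have h2 := hN N.+1 (leqnSn N).
move: h1 h2; rewrite /= bigcup0// big_ord_recr/=.
set S := \sum_(i < N) _ => h1 h2.
have -> : lam set0 = (lam set0 - S) - (lam set0 - (S + lam set0)).
  by rewrite opprB addrK subrK.
apply: le_trans (ropnormD _ _) _; rewrite ropnormN (splitr e) lerD// ltW//.
Qed.

Lemma measureU A B : borel A -> borel B -> A `&` B = set0 ->
  lam (A `|` B) = lam A + lam B.
Proof.
move=> bA bB AB.
have bi i : borel (bigcup2 A B i) by case: i => [|[|i]] //=; exact: borel0.
have ti : trivIset setT (bigcup2 A B).
  by rewrite -trivIset_bigcup2.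
have /cvg_opnorm0 hc := lam_ca bi ti.
apply/eqP; rewrite -subr_eq0; apply/eqP/ropnorm_small0 => e e0.
have [N _ hN] := hc _ e0.
have /ltW := hN N.+2 (leq_trans (leqnSn N) (leqnSn _)).
rewrite /= bigcup2E !big_ord_recl/= big1 ?addr0// => i _.
exact: measure_set0.
Qed.

Lemma measure_fibers (Y : eqType) (t : Omega -> Y) (r : seq Y) :
  (forall y, borel (t @^-1` [set y])) -> uniq r ->
  lam [set x | t x \in r] = \sum_(y <- r) lam (t @^-1` [set y]).
Proof.
move=> bt; elim: r => [_|y r IH /= /andP[yr ur]].
  rewrite big_nil (_ : [set x | _] = set0) ?measure_set0//.
  by apply/seteqP; split.
have br := borel_fibers bt r.
rewrite big_cons -IH// -measureU//.
  congr lam; apply/seteqP; split => x /=; rewrite inE.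
    by move=> /orP[/eqP|]; [left|right].
  by move=> [->|->]; rewrite ?eqxx ?orbT.
by rewrite -subset0 => x [/= ->]; rewrite (negbTE yr).
Qed.

(** The integral can be computed on any finite Borel partition on whose blocks the
    function is constant, here the fibers of t. Distinct fibers may carry the same
    value, and fibers may be empty. *)
Lemma simple_integral_fibers (Y : eqType) (t : Omega -> Y) (r : seq Y) (phi : Y -> E) :
  (forall y, borel (t @^-1` [set y])) -> uniq r -> (forall x, t x \in r) ->
  simple_integral lam (phi \o t) = \sum_(y <- r) lam (t @^-1` [set y]) (phi y).
Proof.
(* Values of phi that t does not reach have an empty fiber and contribute 0. *)
move=> bt ur tr; pose q := undup (map phi r).
have uq : uniq q by exact: undup_uniq.
rewrite /simple_integral (@fsbig_widen _ _ _ _ _ [set` q]).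
- rewrite -fsbig_seq//.
  transitivity (\sum_(e <- q) \sum_(y <- r | phi y == e) lam (t @^-1` [set y]) (phi y)).
    apply: eq_bigr => e _.
    rewrite (_ : _ @^-1` _ = [set x | t x \in [seq y <- r | phi y == e]]).
      rewrite measure_fibers ?filter_uniq// operator_sumE big_filter.
      by apply: eq_bigr => y /eqP ->.
    apply/seteqP; split => x /=; rewrite mem_filter tr andbT.
      by move=> ->.
    by move/eqP.
  rewrite (exchange_big_dep xpredT)//= big_seq [RHS]big_seq.
  apply: eq_bigr => y yr.
  have yq : phi y \in q by rewrite mem_undup; exact: map_f.
  rewrite big_mkcond (bigD1_seq (phi y) yq uq)/= eqxx big1 ?addr0// => e.
  by rewrite eq_sym => /negbTE ->.
- by move=> _ [x _ <-] /=; rewrite mem_undup; exact: map_f.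
- move=> e /= [_ ne]; rewrite (_ : _ @^-1` _ = set0) ?measure_set0//.
  by rewrite -subset0 => x /= xe; apply: ne; exists x.
Qed.

Hypothesis lam_bv : setfun_bounded_variation opnorm lam.

(** Both integrals are computed on the fibers of the pair (s, s'). *)
Lemma simple_integral_bound : exists2 c : R, 0 <= c &
  forall s s' (d : R), simple_function s -> simple_function s' -> 0 <= d ->
  (forall x, rnorm (s x - s' x) <= d) ->
  rnorm (simple_integral lam s - simple_integral lam s' : Kn) <= d * c.
Proof.
have var0 : (0 <= setfun_variation opnorm lam)%E.
  pose P := fun _ : 'I_1 => [set: Omega].
  apply: (@le_trans _ _ (\sum_(i < 1) opnorm (lam (P i)))%E).
    by apply: sume_ge0 => i _; exact: opnorm_ge0.
  apply: ereal_sup_ubound; exists 1%N, P; split => //; split.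
  - by move=> i; apply: borel_open; exact: openT.
  - by move=> i j _ _ _; rewrite !ord1.
  - by apply/seteqP; split => // x _; exists ord0.
exists (fine (setfun_variation opnorm lam)); first exact: fine_ge0.
move=> s s' d [fs bs] [fs' bs'] d0 ss'.
have /finite_seqP[r rE] := fs; have /finite_seqP[r' rE'] := fs'.
pose t x := (s x, s' x).
pose q := undup (allpairs pair r r').
have uq : uniq q by exact: undup_uniq.
have tq x : t x \in q.
  rewrite mem_undup; apply/allpairsP; exists (t x); split => //=.
    by have : range s (s x) by [exists x]; rewrite rE.
  by have : range s' (s' x) by [exists x]; rewrite rE'.
have bt y : borel (t @^-1` [set y]).
  rewrite (_ : _ @^-1` _ = s @^-1` [set y.1] `&` s' @^-1` [set y.2]).
    exact: borelI.
  apply/seteqP; split => x /=; first by move=> <-.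
  by case: y => a b /= [<- <-].
rewrite -[s]/(fst \o t) -[s']/(snd \o t).
rewrite !(simple_integral_fibers _ bt uq tq) -sumrB.
apply: (@le_trans _ _ (\sum_(y <- q) d * ropnorm (lam (t @^-1` [set y])))).
  elim/big_rec2 : _; first by rewrite rnorm0.
  move=> y a b _ ab; apply: le_trans (rnormD _ _) _; rewrite lerD// -operatorB.
  have [[x /= xy]|ne] := pselect (t @^-1` [set y] !=set0).
    apply: le_trans (operator_le_ropnorm _ _) _; rewrite mulrC ler_wpM2r ?ropnorm_ge0//.
    by rewrite -xy; exact: ss'.
  rewrite (_ : _ @^-1` _ = set0) ?measure_set0; last first.
    by rewrite -subset0 => x ?; apply: ne; exists x.
  by rewrite operator_zeroE rnorm0 mulr_ge0// ropnorm_ge0.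
rewrite -mulr_sumr ler_wpM2l// -lee_fin fineK; last first.
  by rewrite ge0_fin_numE.
rewrite -sumEFin; apply: ereal_sup_ubound.
pose y0 := (0, 0) : E * E.
exists (size q), (fun i : 'I_(size q) => t @^-1` [set nth y0 q i]); split.
  split => //.
    move=> i j _ _ [x [/= -> /eqP]]; rewrite nth_uniq// => /eqP; exact: val_inj.
  apply/seteqP; split => // x _.
  have h : (index (t x) q < size q)%N by rewrite index_mem.
  by exists (Ordinal h) => //=; rewrite nth_index.
rewrite (big_nth y0) big_mkord; apply: eq_bigr => i _; exact/esym/ropnormE.
Qed.

End finite_additivity.

(** * Uniqueness of the representing measure *)

Section uniqueness.
Context {R : realType} {k : scalar_kind} {Omega : topologicalType}.
Context {cO : compact [set: Omega]} {E : normedModType (scalar_field R k)}.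
Local Notation K := (scalar_field R k).
Local Notation Kn := (K^o : normedModType K).
Local Notation C := (cfun cO E).
Implicit Types (lam : set Omega -> dual_space E) (l : dual_space C).

(** With N = n.+1, the staircase floor (N * phi) / N is the average of the
    indicators of its N upper level sets, each of which contains Cl and is contained
    in U. Its integral against lam is therefore an average of values lam A x with A
    between Cl and U. Regularity makes lam small on the subsets of U minus Cl, which
    is weaker than smallness of the variation of lam there but is enough for such
    averages. *)
Lemma staircase_average lam (phi : Omega -> R) (B Cl U : set Omega) (e : R) (x : E) n :
  setfun_countably_additive opnorm lam ->
  continuous phi -> (forall t, 0 <= phi t <= 1) ->
  borel B -> borel Cl -> borel U -> Cl `<=` B -> B `<=` U ->
  (forall t, Cl t -> phi t = 1) -> (forall t, ~ U t -> phi t = 0) ->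
  (forall A, borel A -> A `<=` U `\` Cl -> ropnorm (lam A) <= e) ->
  exists s, [/\ simple_function s,
    forall t, rnorm (scalar_of k (phi t) *: x - s t) <= n.+1%:R^-1 * rnorm x &
    rnorm (simple_integral lam s - lam B x : Kn) <= (e + e) * rnorm x].
Proof.
move=> lca cphi phi01 bB bC bU CB BU phi1 phi0 small.
pose N := n.+1.
have N0 : 0 < N%:R :> R by rewrite ltr0n.
pose t w := Num.truncn (N%:R * phi w).
have tN w : (t w <= N)%N.
  have /andP[p0 p1] := phi01 w.
  by rewrite /t truncn_le_nat (le_lt_trans (ler_piMr _ p1))// ltr_nat.
have bge j : borel [set w | (j <= t w)%N].
  apply: borel_closed; rewrite (_ : [set w | _] =
      (fun w => N%:R * phi w) @^-1` [set r | j%:R <= r]).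
    apply: closed_comp; last exact: closed_ge.
    by move=> w _; apply: cvgM; [exact: cvg_cst|exact: cphi].
  apply/seteqP; split => w /=; have /andP[p0 p1] := phi01 w.
    by rewrite truncn_ge_nat// mulr_ge0.
  by rewrite truncn_ge_nat// mulr_ge0.
have bt j : borel (t @^-1` [set j]).
  rewrite (_ : _ @^-1` _ = [set w | (j <= t w)%N] `\` [set w | (j.+1 <= t w)%N]).
    exact: borelD.
  apply/seteqP; split => w /=; first by move=> ->; rewrite ltnn leqnn.
  by move=> [h1 /negP]; rewrite -leqNgt => h2; apply/eqP; rewrite eqn_leq h1 h2.
pose r := iota 0 N.+1.
have ur : uniq r by exact: iota_uniq.
have tr w : t w \in r by rewrite mem_iota/= add0n ltnS tN.
pose st (m : nat) : E := scalar_of k (m%:R / N%:R) *: x.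
exists (st \o t); split.
- exact: simple_function_fibers tr.
- move=> w; rewrite /st /= -scalerBl.
  rewrite -scalar_ofB rnormZr ler_wpM2r ?rnorm_ge0//.
  have /andP[p0 p1] := phi01 w.
  have /truncn_itv/andP[h1 h2] : 0 <= N%:R * phi w by rewrite mulr_ge0.
  rewrite -/(t w) in h1 h2.
  rewrite (_ : phi w - _ = (N%:R * phi w - (t w)%:R) / N%:R); last by field; rewrite gt_eqF.
  rewrite normrM [X in _ * X]ger0_norm ?invr_ge0// ler_piMl ?invr_ge0//.
  rewrite ger0_norm ?subr_ge0// lerBlDr.
  by rewrite addrC natr1 ltW.
rewrite (simple_integral_fibers lca _ bt ur tr).
pose y0 : E := scalar_of k (N%:R^-1) *: x.
have y0N : rnorm y0 = N%:R^-1 * rnorm x by rewrite rnormZr ger0_norm ?invr_ge0.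
have stE m : st m = y0 *+ m by rewrite /st scalar_ofMn scalerMnl.
have xE : x = y0 *+ N.
  by rewrite -stE /st divff ?gt_eqF// scalar_of1 scale1r.
have -> : \sum_(y <- r) lam (t @^-1` [set y]) (st y) =
    \sum_(j < N) lam [set w | (j < t w)%N] y0.
  transitivity (\sum_(y <- r) \sum_(j < N | (j < y)%N) (lam (t @^-1` [set y]) y0 : Kn)).
    rewrite big_seq [RHS]big_seq; apply: eq_bigr => y; rewrite mem_iota /= add0n ltnS => yN.
    rewrite -(big_ord_widen _ (fun=> lam (t @^-1` [set y]) y0) yN).
    by rewrite sumr_const card_ord stE operatorMn.
  rewrite (exchange_big_dep xpredT)//=; apply: eq_bigr => j _.
  rewrite -big_filter -operator_sumE -measure_fibers ?filter_uniq//.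
  congr (lam _ y0); apply/seteqP; split => w; rewrite /mkset mem_filter tr andbT//.
have -> : lam B x = \sum_(j < N) lam B y0.
  by rewrite sumr_const card_ord {1}xE operatorMn.
rewrite -sumrB.
apply: (@le_trans _ _ (\sum_(j < N) (e + e) * rnorm y0)); last first.
  rewrite sumr_const card_ord -[X in X <= _]mulr_natl y0N.
  by rewrite mulrCA mulrA -[in leLHS]mulrA; rewrite mulVKf// ?gt_eqF.
elim/big_rec2 : _; first by rewrite rnorm0.
move=> j a b _ ab; apply: le_trans (rnormD _ _) _; rewrite lerD//.
have bj := bge j.+1.
have dec A : borel A -> Cl `<=` A -> A `<=` U -> lam A = lam Cl + lam (A `\` Cl).
  move=> bA CA AU; rewrite -(measureU lca)//; last 2 first.
  - exact: borelD.
  - by rewrite -subset0 => w [? []].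
  congr lam; apply/seteqP; split => w; last by move=> [/CA|[]].
  by move=> Aw; have [Cw|Cw] := pselect (Cl w); [left|right].
rewrite (dec B)// (dec [set w | (j < t w)%N])//.
- rewrite !operator_addE opprD addrACA subrr add0r.
  apply: le_trans (rnormD _ _) _; rewrite rnormN mulrDl lerD//.
    apply: le_trans (operator_le_ropnorm _ _) _; rewrite ler_wpM2r ?rnorm_ge0// small//.
      exact: borelD.
    move=> w [/= jw nC]; split => //; apply: contrapT => /phi0 pw.
    by move: jw; rewrite /t pw mulr0 truncn0.
  apply: le_trans (operator_le_ropnorm _ _) _; rewrite ler_wpM2r ?rnorm_ge0// small//.
    exact: borelD.
  by move=> w [/BU Uw nC]; split.
- by move=> w /phi1 pw /=; rewrite /t pw mulr1 natrK ltn_ord.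
- move=> w /= jw; apply: contrapT => /phi0 pw.
  by move: jw; rewrite /t pw mulr0 truncn0.
Qed.

(** The simple functions that compute the integral of phi times x are uniformly
    close to a staircase of phi, and the variation of lam controls the difference. *)
Lemma represents_approx lam l (phi : Omega -> R) (cphi : continuous phi)
    (B Cl U : set Omega) (e : R) (x : E) :
  regular_measures lam -> represents lam l -> (forall t, 0 <= phi t <= 1) ->
  borel B -> borel Cl -> borel U -> Cl `<=` B -> B `<=` U ->
  (forall t, Cl t -> phi t = 1) -> (forall t, ~ U t -> phi t = 0) ->
  (forall A, borel A -> A `<=` U `\` Cl -> ropnorm (lam A) <= e) ->
  rnorm (l (scale_cfun cphi (cst_cfun x)) - lam B x : Kn) <= (e + e) * rnorm x.
Proof.
move=> [lca _ lbv] lrep phi01 bB bC bU CB BU phi1 phi0 small.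
have [c c0 hc] := simple_integral_bound lca lbv.
have [s [ss /uniform_cvg_rnormP us /(@cvg_rnormP R k Kn) is_]] :=
  lrep (scale_cfun cphi (cst_cfun x)).
apply: (@ler_addeps _ _ _ (1 + c + c)) => d d0.
have x1 : 0 < rnorm x + 1 by rewrite ltr_wpDl ?rnorm_ge0.
have dx : 0 < d / (rnorm x + 1) by rewrite divr_gt0.
have us2 := us d d0; have is2 := is_ d d0.
near \oo => n.
have [s' [ss' us' is']] := @staircase_average lam phi B Cl U e x n
  lca cphi phi01 bB bC bU CB BU phi1 phi0 small.
have h1 : rnorm (l (scale_cfun cphi (cst_cfun x)) - simple_integral lam (s n) : Kn) < d.
  by near: n; exact: is2.
have h2 : forall t, rnorm ((scale_cfun cphi (cst_cfun x) : C) t - s n t) < d.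
  by near: n; exact: us2.
have h3 : n.+1%:R^-1 * rnorm x <= d.
  have : n.+1%:R^-1 < d / (rnorm x + 1) by near: n; exact: invSn_small.
  rewrite ltr_pdivlMr// => /ltW; apply: le_trans.
  by rewrite ler_wpM2l// lerDl.
have h4 : rnorm (simple_integral lam (s n) - simple_integral lam s' : Kn) <= (d + d) * c.
  apply: hc => //; first by rewrite addr_ge0// ltW.
  move=> w; rewrite (_ : s n w - s' w =
      (scalar_of k (phi w) *: x - s' w) - (scalar_of k (phi w) *: x - s n w)).
    apply: le_trans (rnormD _ _) _; rewrite rnormN lerD//.
      exact: le_trans (us' w) h3.
    by apply: ltW; exact: h2.
  by rewrite opprB [RHS]addrC addrA subrK.
set a := l _ in h1 *; set b := simple_integral lam (s n) in h1 h4.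
set b' := simple_integral lam s' in h4 is'.
have -> : a - lam B x = (a - b) + ((b - b') + (b' - lam B x)).
  by rewrite !addrA !subrK.
apply: le_trans (rnormD _ _) _.
have := rnormD (b - b' : Kn) (b' - lam B x).
move: h1 h4 is'; lra.
Unshelve. all: by end_near. Qed.

(** The union of the closed sets and the intersection of the open sets given by
    the regularity of lam and lam' admit a common Urysohn function phi, so that both
    measures of B are compared with the same value of l. *)
Lemma represents_uniq (hO : hausdorff_space Omega) lam lam' l :
  regular_measures lam -> represents lam l ->
  regular_measures lam' -> represents lam' l ->
  forall B, borel B -> lam B = lam' B.
Proof.
move=> rl repl rl' repl' B bB; apply: operator_ext => x; apply/eqP; rewrite -subr_eq0.
apply/eqP/rnorm_eq0/eqP; rewrite eq_le rnorm_ge0 andbT.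
apply: (@ler_addeps _ _ _ (4 * rnorm x)) => e e0.
have [_ /(_ B bB e e0)[C1 [U1 [cC1 oU1 CB1 BU1 h1]]] _] := rl.
have [_ /(_ B bB e e0)[C2 [U2 [cC2 oU2 CB2 BU2 h2]]] _] := rl'.
pose D := C1 `|` C2; pose U := U1 `&` U2.
have cD : closed D by apply: closedU; exact: compact_closed.
have oU : open U by exact: openI.
have DB : D `<=` B by move=> t [/CB1|/CB2].
have BU : B `<=` U by move=> t Bt; split; [exact: BU1|exact: BU2].
have [phi [cphi phi01 phi1 phi0]] :=
  urysohn_closed_open (R := R) (cO := cO) hO cD oU (subset_trans DB BU).
have bD := borel_closed cD; have bU := borel_open oU.
have s1 A : borel A -> A `<=` U `\` D -> ropnorm (lam A) <= e.
  move=> bA AU; have AU' : A `<=` U1 `\` C1.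
    by move=> t /AU[[U1t U2t] nD]; split => // Ct; apply: nD; left.
  by have := ltW (h1 A bA AU'); rewrite ropnormE lee_fin.
have s2 A : borel A -> A `<=` U `\` D -> ropnorm (lam' A) <= e.
  move=> bA AU; have AU' : A `<=` U2 `\` C2.
    by move=> t /AU[[U1t U2t] nD]; split => // Ct; apply: nD; right.
  by have := ltW (h2 A bA AU'); rewrite ropnormE lee_fin.
have k1 := represents_approx cphi x rl repl phi01 bB bD bU DB BU phi1 phi0 s1.
have k2 := represents_approx cphi x rl' repl' phi01 bB bD bU DB BU phi1 phi0 s2.
set a := l _ in k1 k2.
have -> : lam B x - lam' B x = (a - lam' B x) - (a - lam B x).
  by rewrite opprB [RHS]addrC addrA subrK.
apply: le_trans (rnormD _ _) _; rewrite rnormN add0r.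
move: k1 k2; lra.
Qed.

End uniqueness.

(** * Series of real numbers and of vectors *)

Section real_series.
Context {R : realType}.
Implicit Types a b : nat -> R.

(** The sum of a series with nonnegative terms and bounded partial sums; as a
    supremum, it is estimated through partial sums alone. *)
Definition rsum a : R := sup (range (fun n => \sum_(i < n) a i)).

Lemma rsum_ge a (M : R) n : (forall n, \sum_(i < n) a i <= M) ->
  \sum_(i < n) a i <= rsum a.
Proof.
by move=> h; apply: ub_le_sup; [exists M => _ [m _ <-]|exists n].
Qed.

Lemma rsum_le a (M : R) : (forall n, \sum_(i < n) a i <= M) -> rsum a <= M.
Proof.
by move=> h; apply: ge_sup; [exists (\sum_(i < 0) a i), 0%N|move=> _ [m _ <-]].
Qed.

Lemma rsum_tail a (M e : R) : (forall n, \sum_(i < n) a i <= M) -> 0 < e ->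
  exists N, forall n, (N <= n)%N -> \sum_(N <= i < n) a i <= e.
Proof.
move=> h e0; have [|_ [N _ <-] hN] :=
    @sup_adherent _ (range (fun n => \sum_(i < n) a i)) e e0.
  by split; [exists (\sum_(i < 0) a i), 0%N|exists M => _ [m _ <-]].
exists N => n Nn; have := rsum_ge n h.
have -> : \sum_(i < n) a i = \sum_(i < N) a i + \sum_(N <= i < n) a i.
  by rewrite -!(big_mkord xpredT a) -(big_cat_nat (leq0n N) Nn).
by move: hN; rewrite -/(rsum a); lra.
Qed.

Lemma nneseries_le_real (u : nat -> \bar R) (M : R) : (forall n, 0 <= u n)%E ->
  (forall n, \sum_(i < n) u i <= M%:E)%E -> (\sum_(0 <= i <oo) u i <= M%:E)%E.
Proof.
move=> u0 h; apply: lime_le; first by apply: is_cvg_nneseries => n _ _; exact: u0.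
by apply: nearW => n; rewrite big_mkord.
Qed.

End real_series.

Section weighted_content.
Context {R : realType} {Omega : topologicalType}.

Lemma tight_scale (c : R) (v : set Omega -> R) : 0 <= c -> tight_content v ->
  tight_content (fun U => c * v U).
Proof.
move=> c0 tv; split.
- by move=> U; rewrite mulr_ge0// (content_ge0 tv).
- by move=> U V oU oV UV; rewrite ler_wpM2l// (content_mono tv).
- by move=> U V oU oV; rewrite -mulrDr ler_wpM2l// (contentU tv).
- move=> U oU e e0; have c1 : 0 < c + 1 by rewrite ltr_wpDl.
  have [|S SU vS] := content_tight tv oU (_ : 0 < e / (c + 1)); first by rewrite divr_gt0.
  exists S => //; apply: (@le_trans _ _ ((c + 1) * v (U `\` S))).
    by rewrite ler_wpM2r ?lerDl// (content_ge0 tv).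
  by rewrite mulrC -ler_pdivlMr.
Qed.

Variables (c : nat -> R) (v : nat -> set Omega -> R) (L : nat -> R) (M : R).
Hypotheses (c0 : forall n, 0 <= c n) (tv : forall n, tight_content (v n)).
Hypotheses (vL : forall n U, v n U <= L n) (cLM : forall n, \sum_(i < n) c i * L i <= M).

Lemma weighted_content_partial U n : \sum_(i < n) c i * v i U <= M.
Proof. by apply: le_trans (cLM n); apply: ler_sum => i _; rewrite ler_wpM2l. Qed.

Lemma weighted_content_ge U n : \sum_(i < n) c i * v i U <= rsum (fun n => c n * v n U).
Proof. exact: (@rsum_ge _ (fun n => c n * v n U) M n (@weighted_content_partial U)). Qed.

(** For tightness, unite closed sets adapted to finitely many of the contents, and
    bound the contribution of the others by the tail of the series of c n * L n. *)
Lemma weighted_content_tight : tight_content (fun U => rsum (fun n => c n * v n U)).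
Proof.
split.
- by move=> U; have := weighted_content_ge U 0; rewrite big_ord0.
- move=> U V oU oV UV; apply: rsum_le => n; apply: le_trans (weighted_content_ge V n).
  by apply: ler_sum => i _; rewrite ler_wpM2l// (content_mono (tv i)).
- move=> U V oU oV; apply: rsum_le => n.
  apply: (@le_trans _ _ (\sum_(i < n) (c i * v i U + c i * v i V))).
    by apply: ler_sum => i _; rewrite -mulrDr ler_wpM2l// (contentU (tv i)).
  by rewrite big_split/= lerD// weighted_content_ge.
move=> U oU e e0; have e2 : 0 < e / 2 by rewrite divr_gt0.
have [N hN] := @rsum_tail _ (fun i => c i * L i) _ _ cLM e2.
have d0 i : 0 < e / 2 / (2 ^ i.+1)%:R by rewrite divr_gt0// ltr0n expn_gt0.
have /choice[S hS] i : exists S,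
    [/\ closed S, S `<=` U & c i * v i (U `\` S) <= e / 2 / (2 ^ i.+1)%:R].
  have [S [cS SU] h] := content_tight (tight_scale (c0 i) (tv i)) oU (d0 i).
  by exists S.
have cS i : closed (S i) by have [] := hS i.
have cSN : closed (\big[setU/set0]_(i < N) S i) by exact: closed_bigsetU.
exists (\big[setU/set0]_(i < N) S i).
  split => //; rewrite -bigcup_mkord => t [i _ St].
  by have [_ + _] := hS i; apply.
have oD := openD oU cSN.
apply: rsum_le => n.
pose b i := c i * v i (U `\` \big[setU/set0]_(i < N) S i).
have b0 i : 0 <= b i by rewrite mulr_ge0// (content_ge0 (tv i)).
apply: (@le_trans _ _ (\sum_(0 <= i < maxn N n) b i)).
  rewrite -(big_mkord xpredT b) (big_cat_nat (leq0n n) (leq_maxr N n))//= lerDl.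
  by rewrite sumr_ge0.
rewrite (big_cat_nat (leq0n N) (leq_maxl N n))//= (splitr e) lerD//.
  rewrite big_mkord; apply: le_trans (geo_half_le N e2).
  apply: ler_sum => i _; have [_ _ h] := hS i; apply: le_trans h.
  rewrite ler_wpM2l// (content_mono (tv i))//; first exact: openD.
  by apply: setDS; rewrite -bigcup_mkord => t ?; exists i => /=.
apply: le_trans (hN _ (leq_maxl N n)); rewrite big_seq [leRHS]big_seq.
by apply: ler_sum => i _; rewrite ler_wpM2l.
Qed.
End weighted_content.

Section vector_series.
Context {R : realType} {k : scalar_kind}.
Local Notation K := (scalar_field R k).

Lemma rnorm_sum (V : normedModType K) (I : Type) (r : seq I) (P : pred I) (u : I -> V) :
  rnorm (\sum_(i <- r | P i) u i) <= \sum_(i <- r | P i) rnorm (u i).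
Proof.
elim/big_rec2 : _; first by rewrite rnorm0.
by move=> i y z _ zy; apply: le_trans (rnormD _ _) _; rewrite lerD2l.
Qed.

Lemma cvg_sum_seq (V : normedModType K) (I : Type) (r : seq I) (u : I -> nat -> V)
    (z : I -> V) : (forall i, u i @ \oo --> z i) ->
  (fun n => \sum_(i <- r) u i n) @ \oo --> \sum_(i <- r) z i.
Proof.
move=> h; elim: r => [|i r IH].
  rewrite big_nil (_ : (fun n => _) = fun=> 0); first exact: cvg_cst.
  by apply/funext => n; rewrite big_nil.
rewrite big_cons (_ : (fun n => _) = (fun n => u i n + \sum_(i <- r) u i n)).
  by apply: cvgD => //; exact: h.
by apply/funext => n; rewrite big_cons.
Qed.

Lemma series_bound (V : normedModType K) (u : nat -> V) (z : V) (M : R) :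
  series u @ \oo --> z -> (forall n, \sum_(i < n) rnorm (u i) <= M) -> rnorm z <= M.
Proof.
move=> /cvg_rnormP uz h; apply/ler_addgt0Pl => e e0.
near \oo => n.
have h1 : rnorm (z - series u n) < e by near: n; exact: uz.
rewrite -[z](subrK (series u n)) (le_trans (rnormD _ _))// lerD//; first exact: ltW.
by rewrite /series/= big_mkord (le_trans (rnorm_sum _ _ _))// h.
Unshelve. all: by end_near. Qed.

Lemma series_cvg_rnorm (V : completeNormedModType K) (u : nat -> V) (M : R) :
  (forall n, \sum_(i < n) rnorm (u i) <= M) -> exists z : V, series u @ \oo --> z.
Proof.
move=> h; apply: cauchy_rnorm_cvg => e e0.
have e2 : 0 < e / 2 by rewrite divr_gt0.
have [N hN] := @rsum_tail _ (fun i => rnorm (u i)) _ _ h e2; exists N.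
suff wl m n : (N <= m)%N -> (m <= n)%N -> rnorm (series u n - series u m) < e.
  move=> m n Nm Nn; have [mn|nm] := leqP m n; last exact/wl/ltnW.
  by rewrite -rnormN opprB wl.
move=> Nm mn; rewrite sub_series_geq//.
apply: le_lt_trans (rnorm_sum _ _ _) _.
apply: (@le_lt_trans _ _ (\sum_(N <= i < n) rnorm (u i))).
  rewrite (big_cat_nat Nm mn)/= lerDr sumr_ge0// => i _; exact: rnorm_ge0.
apply: le_lt_trans (hN _ (leq_trans Nm mn)) _.
by rewrite ltr_pdivrMr// ltr_pMr// ltr1n.
Qed.

Lemma nuclear_operator_exists (X : normedModType K) (Y : completeNormedModType K)
    (l : nat -> dual_space X) (y : nat -> Y) (M : R) :
  (forall n, \sum_(i < n) ropnorm (l i) * rnorm (y i) <= M) ->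
  exists S : operator X Y, nuclear_representation S l y.
Proof.
move=> h.
have hx x n : \sum_(i < n) rnorm (l i x *: y i) <= M * rnorm x.
  apply: le_trans (ler_wpM2r (rnorm_ge0 x) (h n)); rewrite mulr_suml.
  apply: ler_sum => i _; rewrite rnormZ mulrAC ler_wpM2r ?rnorm_ge0//.
  exact: operator_le_ropnorm.
have /choice[S hS] x := @series_cvg_rnorm _ (fun n => l n x *: y n) _ (hx x).
have lS : linear S.
  move=> a x x'; apply: (cvg_unique _ (hS _)) => //=.
  rewrite (_ : series _ = (fun n => a *: series (fun n => l n x *: y n) n +
      series (fun n => l n x' *: y n) n)).
    by apply: cvgD; [apply: cvgZl_tmp; exact: hS|exact: hS].
  apply/funext => n; rewrite /series /= scaler_sumr -big_split/=.
  apply: eq_bigr => i _; rewrite operatorD operatorZ scalerDl scalerA//.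
have bS x : rnorm (S x) <= M * rnorm x by exact: series_bound (hS x) (hx x).
by exists (Operator (bounded_operator lS bS)).
Qed.

End vector_series.

(** * The representing measure of a functional and of a nuclear operator *)

Section singer_theorem.
Context {R : realType} {k : scalar_kind} {Omega : topologicalType}.
Context {cO : compact [set: Omega]} {E : normedModType (scalar_field R k)}.
Local Notation K := (scalar_field R k).
Local Notation Kn := (K^o : normedModType K).
Local Notation C := (cfun cO E).
Variables (hO : hausdorff_space Omega) (l : dual_space C) (v : set Omega -> R).
Hypotheses (tv : tight_content v) (lv : dominated l v).

Lemma lusin_measure_exists : exists lam : set Omega -> dual_space E,
  forall B e, borel B -> lusin_integral l v (indic_vec B e) (lam B e).
Proof.
have /choice[lam hlam] B : exists L : dual_space E,
    borel B -> forall e, lusin_integral l v (indic_vec B e) (L e).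
  have [bB|nB] := pselect (borel B); last by exists 0.
  by have [L hL] := lusin_indic tv lv hO bB; exists L.
by exists lam => B e bB; exact: hlam.
Qed.

(** [measure_of l] is a choice among the regular measures representing l. The
    Lusin integrals form such a measure, and uniqueness identifies the two. *)
Lemma measure_of_lusin (lam : set Omega -> dual_space E) :
  (forall B e, borel B -> lusin_integral l v (indic_vec B e) (lam B e)) ->
  forall B, borel B -> measure_of l B = lam B.
Proof.
move=> hlam.
have rl : regular_measures lam.
  have small := lusin_measure_small tv lv hlam.
  split.
  - exact: (content_countably_additive cO tv small (lusin_measure_additive tv lv hlam)).
  - exact: (content_regular cO tv small).
  - apply: (@le_lt_trans _ _ (v setT)%:E); last exact: ltry.
    apply: ge_ereal_sup => _ [n [P [bP ->]]].
    exact: (lusin_measure_variation tv lv hlam bP).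
have repl := lusin_measure_represents tv lv hlam.
have [r1 r2] : regular_measures (measure_of l) /\ represents (measure_of l) l.
  apply: (@xgetPex _ (fun=> 0)
    [set lam | regular_measures lam /\ represents lam l]).
  by exists lam.
exact: represents_uniq r1 r2 rl repl.
Qed.

End singer_theorem.

Section nuclear_facts.
Context {R : realType} {k : scalar_kind}.
Context {X Y : normedModType (scalar_field R k)}.
Implicit Types (S : operator X Y) (l : nat -> dual_space X) (y : nat -> Y).

Lemma nuclear_term_ge0 l y n : (0 <= opnorm (l n) * (rnorm (y n))%:E)%E.
Proof. by rewrite mule_ge0 ?opnorm_ge0// lee_fin rnorm_ge0. Qed.

Lemma nuclear_norm_ge0 S : (0 <= nuclear_norm S)%E.
Proof.
apply: le_ereal_inf_tmp => _ [l [y [_ ->]]].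
by apply: nneseries_ge0 => n _ _; exact: nuclear_term_ge0.
Qed.

Lemma nuclear_norm_le S l y : nuclear_representation S l y ->
  (nuclear_norm S <= nuclear_sum l y)%E.
Proof. by move=> Sly; apply: ereal_inf_lbound; exists l, y. Qed.

Lemma nuclear_sum_le l y (M : R) :
  (forall n, \sum_(i < n) ropnorm (l i) * rnorm (y i) <= M) ->
  (nuclear_sum l y <= M%:E)%E.
Proof.
move=> h; apply: nneseries_le_real => n; first exact: nuclear_term_ge0.
under eq_bigr do rewrite ropnormE -EFinM.
by rewrite sumEFin lee_fin.
Qed.

Lemma nuclear_sum_partial l y : (nuclear_sum l y < +oo)%E -> exists M : R,
  forall n, \sum_(i < n) ropnorm (l i) * rnorm (y i) <= M.
Proof.
move=> h; exists (fine (nuclear_sum l y)) => n.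
rewrite -lee_fin fineK; last first.
  rewrite ge0_fin_numE//; apply: nneseries_ge0 => i _ _; exact: nuclear_term_ge0.
rewrite -sumEFin -(big_mkord xpredT (fun i => (ropnorm (l i) * rnorm (y i))%:E)).
under eq_bigr do rewrite EFinM -ropnormE.
apply: nneseries_lim_ge => i _ _; exact: nuclear_term_ge0.
Qed.
End nuclear_facts.


Section nuclear_operator_measure.
Context {R : realType} {k : scalar_kind} {Omega : topologicalType}.
Context {cO : compact [set: Omega]} {E F : completeNormedModType (scalar_field R k)}.
Local Notation K := (scalar_field R k).
Local Notation Kn := (K^o : normedModType K).
Local Notation C := (cfun cO E).
Variables (hO : hausdorff_space Omega) (T : operator C F).
Variables (l : nat -> dual_space C) (y : nat -> F) (M : R).
Hypothesis Tly : nuclear_representation T l y.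
Hypothesis hM : forall n, \sum_(i < n) ropnorm (l i) * rnorm (y i) <= M.
Variable lam : nat -> set Omega -> dual_space E.
Hypothesis hlam : forall n B e, borel B ->
  lusin_integral (l n) (content_of (l n)) (indic_vec B e) (lam n B e).
Variable G : set Omega -> operator E F.
Hypothesis hG : forall B, borel B -> nuclear_representation (G B) (fun n => lam n B) y.

Let tv n : tight_content (content_of (l n)) := content_of_tight hO (l n).
Let lv n : dominated (l n) (content_of (l n)) := @content_of_dominated _ _ _ _ _ (l n).
Let y0 n : 0 <= rnorm (y n) := rnorm_ge0 (y n).
Let cL n U : content_of (l n) U <= ropnorm (l n) := content_of_ropnorm (l n) U.
Let hM' n : \sum_(i < n) rnorm (y i) * ropnorm (l i) <= M.
Proof. by under eq_bigr do rewrite mulrC. Qed.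

(** A single content that controls T and all the terms of its representation. *)
Definition nuclear_content (U : set Omega) : R :=
  rsum (fun n => rnorm (y n) * content_of (l n) U).
Local Notation v := nuclear_content.

Lemma nuclear_content_tight : tight_content v.
Proof. exact: weighted_content_tight y0 tv cL hM'. Qed.

Lemma nuclear_content_ge U n : \sum_(i < n) rnorm (y i) * content_of (l i) U <= v U.
Proof. exact: (weighted_content_ge y0 cL hM' U n). Qed.

Lemma nuclear_measure_partial D W n : borel D -> open W -> D `<=` W ->
  \sum_(i < n) ropnorm (lam i D) * rnorm (y i) <= v W.
Proof.
move=> bD oW DW; apply: le_trans (nuclear_content_ge W n); apply: ler_sum => i _.
rewrite mulrC ler_wpM2l// -lee_fin -ropnormE.
by have /andP[] := lusin_measure_small (tv i) (lv i) (hlam i) bD oW DW.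
Qed.

Lemma nuclear_measure_small D W : borel D -> open W -> D `<=` W ->
  (0 <= nuclear_norm (G D) <= (v W)%:E)%E.
Proof.
move=> bD oW DW; rewrite nuclear_norm_ge0/=.
apply: le_trans (nuclear_norm_le (hG bD)) _.
by apply: nuclear_sum_le => n; exact: nuclear_measure_partial.
Qed.

Lemma nuclear_dominated (ys : dual_space F) :
  dominated (operator_comp ys T) (fun U => ropnorm ys * v U).
Proof.
move=> f U N oU N0 fU fN /=; have Tf := @Tly f; apply: le_trans (operator_le_ropnorm ys (T f)) _.
rewrite mulrCA ler_wpM2l ?ropnorm_ge0// (series_bound Tf)// => n.
apply: le_trans (ler_wpM2l N0 (nuclear_content_ge U n)); rewrite mulr_sumr.
apply: ler_sum => i _; rewrite rnormZ mulrCA mulrC ler_wpM2l//.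
exact: (content_of_dominated (l i) oU N0 fU fN).
Qed.

(** The errors of the terms, for the same f and O, add up to the content of O. *)
Lemma nuclear_measure_approx D (x : E) (f : C) O : borel D -> open O ->
  (forall t, ~ O t -> f t = indic_vec D x t) -> (forall t, rnorm (f t) <= rnorm x) ->
  rnorm (G D x - T f) <= 2 * rnorm x * v O.
Proof.
move=> bD oO fO fx.
have hd : series (fun n => (lam n D x - l n f) *: y n) @ \oo --> G D x - T f.
  rewrite (_ : series _ = (fun n => series (fun n => lam n D x *: y n) n -
      series (fun n => l n f *: y n) n)).
    by apply: cvgB; [exact: hG|exact: Tly].
  apply/funext => n; rewrite /series /= -sumrB; apply: eq_bigr => i _.
  by rewrite scalerBl.
apply: (series_bound hd) => n.
apply: le_trans (ler_wpM2l _ (nuclear_content_ge O n)); last first.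
  by rewrite mulr_ge0// rnorm_ge0.
rewrite mulr_sumr; apply: ler_sum => i _; rewrite rnormZ mulrCA mulrC ler_wpM2l//.
exact: (lusin_indic_error (tv i) (lv i) (hlam i x bD) oO fO fx).
Qed.

Lemma nuclear_measure_lusin (ys : dual_space F) D (x : E) : borel D ->
  lusin_integral (operator_comp ys T) (fun U => ropnorm ys * v U)
    (indic_vec D x) (ys (G D x)).
Proof.
move=> bD; exists (rnorm x) => d d0; set c := ropnorm ys.
have c0 : 0 <= c by exact: ropnorm_ge0.
have x0 : 0 <= rnorm x by exact: rnorm_ge0.
(* Content at most a makes both c * v O and c * (2 * rnorm x * v O) at most d. *)
pose a := d / (c + 1) / (2 * rnorm x + 1).
have c1 : 0 < c + 1 by rewrite ltr_wpDl.
have x1 : 0 < 2 * rnorm x + 1 by rewrite ltr_wpDl// mulr_ge0.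
have a0 : 0 < a by rewrite !divr_gt0.
have [f [ O [oO vO fO fx]]] :=
  indic_vec_approximation (cO := cO) nuclear_content_tight hO x bD a0.
have [cxv cv] : c * (2 * rnorm x * v O) <= d /\ c * v O <= d.
  have vO0 := content_ge0 nuclear_content_tight O.
  have h : (c + 1) * ((2 * rnorm x + 1) * v O) <= d.
    by rewrite mulrC -ler_pdivlMr// mulrC -ler_pdivlMr.
  have cv := mulr_ge0 c0 vO0; have xv := mulr_ge0 x0 vO0.
  by split; apply: le_trans h; move: vO0 x0 cv xv (mulr_ge0 c0 xv); nra.
exists f, O; split => //=.
rewrite -operatorB; apply: le_trans (operator_le_ropnorm ys _) _.
by apply: le_trans cxv; rewrite ler_wpM2l// nuclear_measure_approx.
Qed.

(** The operators ys o G B have as values Lusin integrals for the functional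
    ys o T, so they form the measure that represents it. *)
Lemma nuclear_measure_representing B e : borel B ->
  canonical_embedding (G B e) = representing_measure T B e.
Proof.
move=> bB; apply/funext => ys.
rewrite /canonical_embedding /representing_measure /second_adjoint /evaluation.
have tv' := tight_scale (ropnorm_ge0 ys) nuclear_content_tight.
have hys D x := @nuclear_measure_lusin ys D x.
by rewrite (measure_of_lusin hO tv' (@nuclear_dominated ys)
  (lam := fun B => operator_comp ys (G B)) hys bB).
Qed.

Lemma nuclear_measure_additive (B : nat -> set Omega) : (forall i, borel (B i)) ->
  trivIset setT B ->
  forall n, G (\bigcup_i B i) - \sum_(i < n) G (B i) = G (\bigcup_i B (n + i)%N).
Proof.
move=> bB tB n.
have bU : borel (\bigcup_i B i) by exact: borel_bigcup.
have bUn : borel (\bigcup_i B (n + i)%N) by apply: borel_bigcup.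
apply/operator_ext => x; rewrite operator_addE operator_oppE operator_sumE.
apply: (@cvg_unique _ _ _ _ _ _ _ (@hG _ bUn x)) => //=.
have hs : series (fun m => (\sum_(i < n) lam m (B i) x) *: y m) @ \oo -->
    \sum_(i < n) G (B i) x.
  rewrite (_ : series _ =
      (fun m => \sum_(i < n) series (fun m => lam m (B i) x *: y m) m)).
    by apply: cvg_sum_seq => i; exact: hG.
  apply/funext => m; rewrite /series /= exchange_big /=; apply: eq_bigr => i _.
  by rewrite scaler_suml.
rewrite (_ : series _ = (fun m => series (fun m => lam m (\bigcup_i B i) x *: y m) m -
    series (fun m => (\sum_(i < n) lam m (B i) x) *: y m) m)).
  by apply: cvgB => //; exact: hG.
apply/funext => m; rewrite /series /= -sumrB; apply: eq_bigr => i _.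
rewrite -scalerBl; congr (_ *: _).
rewrite -(lusin_measure_additive (tv i) (lv i) (hlam i) bB tB n).
by rewrite operator_addE operator_oppE operator_sumE.
Qed.

(** For each term of the series, the sum over the blocks is at most the total
    content of l n; it remains to exchange the two sums. *)
Lemma nuclear_measure_variation n (P : 'I_n -> set Omega) : borel_partition P ->
  (\sum_(i < n) nuclear_norm (G (P i)) <= (v setT)%:E)%E.
Proof.
move=> bP; have bPi i : borel (P i) by have [] := bP.
apply: (@le_trans _ _ (\sum_(i < n) nuclear_sum (fun m => lam m (P i)) y)%E).
  by apply: lee_sum => i _; exact: (nuclear_norm_le (hG (bPi i))).
have term0 i m := nuclear_term_ge0 (fun m => lam m (P i)) y m.
rewrite /nuclear_sum -nneseries_sum//.
apply: nneseries_le_real => m; first exact: sume_ge0.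
apply: (@le_trans _ _ (\sum_(j < m) (rnorm (y j) * content_of (l j) setT)%:E)%E).
  apply: lee_sum => j _; rewrite -ge0_sume_distrl; last by move=> i _; exact: opnorm_ge0.
  rewrite EFinM muleC lee_pmul// ?lee_fin//.
    by apply: sume_ge0 => i _; exact: opnorm_ge0.
  exact: (lusin_measure_variation (tv j) (lv j) (hlam j) bP).
by rewrite sumEFin lee_fin nuclear_content_ge.
Qed.

End nuclear_operator_measure.

Theorem proposition1 (R : realType) (k : scalar_kind) (Omega : topologicalType)
    (cO : compact [set: Omega]) (hO : hausdorff_space Omega)
    (E F : completeNormedModType (scalar_field R k))
    (T : operator (cfun cO E) F) (nucT : nuclear T) :
  exists G : set Omega -> operator E F,
    [/\ forall B e, borel B ->
          canonical_embedding (G B e) = representing_measure T B e,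
        forall B, borel B -> nuclear (G B),
        setfun_countably_additive nuclear_norm G
      & setfun_bounded_variation nuclear_norm G].
Proof.
have [l [y [Tly /nuclear_sum_partial[M hM]]]] := nucT.
have /choice[lam hlam] n := lusin_measure_exists hO (content_of_tight hO (l n))
  (@content_of_dominated _ _ _ _ _ (l n)).
have lamT B n : borel B -> \sum_(i < n) ropnorm (lam i B) * rnorm (y i) <=
    nuclear_content l y setT.
  by move=> bB; exact: (nuclear_measure_partial hO hM hlam n bB openT (@subsetT _ B)).
have /choice[G hG] B : exists S : operator E F, borel B ->
    nuclear_representation S (fun n => lam n B) y.
  have [bB|nB] := pselect (borel B); last by exists 0.
  have [S hS] := @nuclear_operator_exists _ _ _ _ (fun n => lam n B) y _
    (fun n => lamT B n bB).
  by exists S.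
exists G; split.
- by move=> B e bB; exact: (nuclear_measure_representing hO Tly hM hlam hG e bB).
- move=> B bB; exists (fun n => lam n B), y; split; first exact: hG.
  have h := @nuclear_sum_le _ _ _ _ (fun n => lam n B) y _ (fun n => lamT B n bB).
  exact: le_lt_trans h (ltry _).
- apply: (content_countably_additive cO (nuclear_content_tight hO hM)).
  + exact: (nuclear_measure_small hO hM hlam hG).
  + exact: (nuclear_measure_additive hO hlam hG).
- apply: (@le_lt_trans _ _ (nuclear_content l y setT)%:E); last exact: ltry.
  apply: ge_ereal_sup => _ [n [P [bP ->]]].
  exact: (nuclear_measure_variation hO hM hlam hG bP).
Qed.
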